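(* Consider the stochastic minimax problem $\min_{x}\max_{y}\phi(x,y)$, $\phi(x,y)=\vartheta(x)+f(x,y)-\omega(y)$, with the setting, oracle, algorithm (SAPS) and averaged iterate described in the context, and assume (A1)–(A3) and (B1)–(B3) hold (with the constant $\theta>0$ and function value $q(\theta)>0$ of (B3)). Let $N>0$ be an integer and let $z^1,\dots,z^N$ be generated by SAPS with step sizes $\gamma_k=\theta\|z^1-z^*\|/(M_*\sqrt N)$, $k=1,\dots,N$, and $\widetilde z^N$ the averaged iterate. Then for any $\Omega>4$, $$\mathrm{Prob}\left\{\epsilon_\phi(\widetilde z^N)\ge \frac{\|z^1-z^*\|M_*\max\{\theta,\theta^{-1}\}}{2\sqrt N}\big(3+2q(\theta)(1+q(\theta))\big)\Omega\right\}\le 2\exp\{-\Omega\}.$$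
   Context: Setting: $\vartheta:\mathbb{R}^n\to\mathbb{R}\cup\{+\infty\}$, $\omega:\mathbb{R}^m\to\mathbb{R}\cup\{+\infty\}$ proper lower semicontinuous convex; $\xi$ random vector supported on $\Xi\subseteq\mathbb{R}^q$; $F:\mathbb{R}^n\times\mathbb{R}^m\times\Xi\to\mathbb{R}$, $f(x,y)=\mathbb{E}[F(x,y,\xi)]$ finite, continuous, convex in $x$, concave in $y$ on $\mathbb{Z}:=\mathrm{dom}\,\vartheta\times\mathrm{dom}\,\omega$; $z=(x,y)$; $\mathrm{Prox}_{\gamma h}(u)=\mathrm{argmin}_w\{h(w)+\frac{1}{2\gamma}\|w-u\|^2\}$. (A1) Samples $\xi_1,\xi_2,\dots$ are i.i.d. copies of $\xi$. (A2) An oracle returns $G_x(x,y,\xi)$, $G_y(x,y,\xi)$ with $g_x:=\mathbb{E}[G_x]\in\partial_xf(x,y)$, $g_y:=\mathbb{E}[G_y]$, $-g_y\in\partial_y[-f](x,y)$; $G(z,\xi)=(G_x(z,\xi),-G_y(z,\xi))$, $g(z)=(g_x(z),-g_y(z))$. (A3) There is $z^*=(x^*,y^* )\in\mathbb{Z}$ with $\phi(x^*,y)\le\phi(x^*,y^* )\le\phi(x,y^* )$ for all $(x,y)\in\mathbb{Z}$; $\epsilon_\phi(z)=\phi(x,y^* )-\phi(x^*,y)$. (B1) There is $M_*>0$ such that for every $z\in\mathbb{Z}$ there exist $v_x(x)\in\partial\vartheta(x)$, $v_y(y)\in\partial\omega(y)$, $v(z)=(v_x(x),v_y(y))$, with $\mathbb{E}[\exp\{\|v(z)+G(z,\xi)\|^2/M_*^2\}]\le\exp\{1\}$.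 (B2) There is $\kappa_0>0$ with $\|G(z,\xi)\|\le\kappa_0$ for all $z\in\mathbb{Z}$, $\xi\in\Xi$. (B3) For $\theta>0$, if $\{z^k\}$ is generated by SAPS with step sizes $\gamma_k=\theta\|z^1-z^*\|/(M_*\sqrt N)$, then $\|z^k-z^*\|\le(1+q(\theta))\|z^1-z^*\|$ for all $k>1$, where $q(\theta)>0$ is a constant depending on $\theta$. SAPS: given $z^1=(x^1,y^1)$ and $\gamma_k>0$: $x^{k+1}=\mathrm{Prox}_{\gamma_k\vartheta}(x^k-\gamma_kG_x(x^k,y^k,\xi_k))$, $y^{k+1}=\mathrm{Prox}_{\gamma_k\omega}(y^k+\gamma_kG_y(x^k,y^k,\xi_k))$. Averaged iterate $\widetilde z^N=\sum_{j=1}^N(\gamma_j/\sum_{i=1}^N\gamma_i)z^j$. *)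

(* Defs.v *)
From HB Require Import structures.
From mathcomp Require Import all_boot all_order all_algebra.
From mathcomp Require Import all_classical all_reals all_analysis.
Set Implicit Arguments. Unset Strict Implicit. Unset Printing Implicit Defensive.
Import Order.TTheory GRing.Theory Num.Theory.
Import numFieldNormedType.Exports.
Local Open Scope classical_set_scope.
Local Open Scope ring_scope.

Section Defs.
Variable R : realType.

Definition dotv n (u v : 'rV[R]_n) : R := \sum_(i < n) u ord0 i * v ord0 i.
Definition enorm n (v : 'rV[R]_n) : R := Num.sqrt (dotv v v).

Definition znorm n m (z : 'rV[R]_n * 'rV[R]_m) : R :=
  Num.sqrt (dotv z.1 z.1 + dotv z.2 z.2).

Definition edom n (h : 'rV[R]_n -> \bar R) : set 'rV[R]_n :=
  [set x | (h x < +oo)%E].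

Definition proper_fun n (h : 'rV[R]_n -> \bar R) : Prop :=
  (forall x, (-oo < h x)%E) /\ (exists x, (h x < +oo)%E).

(** convexity of an extended-real valued function (values in (-oo,+oo]). *)
Definition econvex n (h : 'rV[R]_n -> \bar R) : Prop :=
  forall (x y : 'rV[R]_n) (l : R), 0 < l < 1 ->
    (h (l *: x + (1 - l) *: y)%R <= l%:E * h x + (1 - l)%:E * h y)%E.

Definition convex_on n (D : set 'rV[R]_n) (h : 'rV[R]_n -> R) : Prop :=
  forall (x y : 'rV[R]_n) (l : R), D x -> D y -> 0 < l < 1 ->
    h (l *: x + (1 - l) *: y) <= l * h x + (1 - l) * h y.

Definition esubdiff n (h : 'rV[R]_n -> \bar R) (x : 'rV[R]_n) : set 'rV[R]_n :=
  [set v | forall w, (h x + (dotv v (w - x)%R)%:E <= h w)%E].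

Definition subdiff_on n (D : set 'rV[R]_n) (h : 'rV[R]_n -> R) (x : 'rV[R]_n)
  : set 'rV[R]_n :=
  [set v | forall w, D w -> h x + dotv v (w - x) <= h w].

Definition is_prox n (h : 'rV[R]_n -> \bar R) (gamma : R) (u p : 'rV[R]_n) : Prop :=
  forall w, (h p + (enorm (p - u)%R ^+ 2 / (2 * gamma))%:E
             <= h w + (enorm (w - u)%R ^+ 2 / (2 * gamma))%:E)%E.

(** Borel sigma-algebra on R^n = 'rV[R]_n: generated by the coordinate maps. *)
Definition coord_sets n : set (set 'rV[R]_n) :=
  [set B | exists (i : 'I_n) (A : set R), measurable A /\
                  B = (fun v : 'rV[R]_n => v ord0 i) @^-1` A].
End Defs.

Notation Vec R n := (g_sigma_algebraType (@coord_sets R n)).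

Definition mutually_independent {d dX} {T : measurableType d}
  {X : measurableType dX} {R : realType} (P : probability T R)
  (I : set nat) (xi : nat -> T -> X) : Prop :=
  forall (s : seq nat) (A : nat -> set X), uniq s -> {subset s <= I} ->
    (forall k, measurable (A k)) ->
    P (\bigcap_(k in [set` s]) (xi k @^-1` A k)) =
    (\prod_(k <- s) P (xi k @^-1` A k))%E.

Definition same_law {d dX} {T : measurableType d}
  {X : measurableType dX} {R : realType} (P : probability T R)
  (xi xi' : T -> X) : Prop :=
  forall A : set X, measurable A -> P (xi' @^-1` A) = P (xi @^-1` A).

Definition oracle_measurable {R : realType} {dX} {Xi : measurableType dX}
  n m p (G : 'rV[R]_n -> 'rV[R]_m -> Xi -> 'rV[R]_p) : Prop :=
  forall i : 'I_p, measurable_fun setT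
    (fun w : (Vec R n * Vec R m) * Xi => G w.1.1 w.1.2 w.2 ord0 i).

Section Minimax.
Variables (R : realType) (n m : nat).
Variables (vt : 'rV[R]_n -> \bar R) (om : 'rV[R]_m -> \bar R)
          (f : 'rV[R]_n -> 'rV[R]_m -> R).

Definition phi (x : 'rV[R]_n) (y : 'rV[R]_m) : \bar R :=
  (vt x + (f x y)%:E - om y)%E.

Definition Zdom : set ('rV[R]_n * 'rV[R]_m) :=
  [set z | edom vt z.1 /\ edom om z.2].

Definition eps_phi (xs : 'rV[R]_n) (ys : 'rV[R]_m)
  (z : 'rV[R]_n * 'rV[R]_m) : \bar R :=
  (phi z.1 ys - phi xs z.2)%E.
End Minimax.

(* Main.v *)
(* Write zs for the saddle point, D = ||z^1 - zs||, r = 1 + q(theta),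
   h = vartheta + omega, and let g = E[G].
   Convexity in x and concavity in y bound the gap at z^k by
   h(z^k) - h(zs) + <g(z^k), z^k - zs>.  Since ||v + g|| <= M, this is at most
   r D M for every k, which is already below the threshold when N <= 16.

   For larger N, the strong convexity of the proximal subproblem gives
     gap(z^k) <= (||z^k - zs||^2 - ||z^(k+1) - zs||^2) / (2 gamma)
                 + (gamma/2) M^2 s_k + <g - G, z^k - zs>,
   with s_k <= ||v + G||^2 / M^2 expressed through the Moreau envelope of h.
   Averaging and Jensen's inequality reduce the event to S + r V >= (1 + 2r) Omega - 1,
   where S is the mean of the s_k and V is a normalized martingale sum.  Freezing
   the past in each factor yields E[exp S] <= e and E[exp V] <= e^3, and Markov's
   inequality is applied to exp (S/(1+r) + r V/(1+r)). *)
Require Import Defs.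
From HB Require Import structures.
From mathcomp Require Import all_boot all_order all_algebra.
From mathcomp Require Import all_classical all_reals all_analysis.
From mathcomp Require Import measurable_realfun ring lra.
Import Order.TTheory GRing.Theory Num.Theory.
Import numFieldNormedType.Exports.
Local Open Scope classical_set_scope.
Local Open Scope ring_scope.

Set Implicit Arguments.
Unset Strict Implicit.

(** * Exponential inequalities *)

(** Two obstacles shape the argument. The subgradients in (B1) are picked separately at every point,
    so ||v + G||^2 along the iterates need not be measurable: only expressions free of v are
    integrated over the samples, and v enters once the past is frozen and v is a constant vector.
    The split at N = 16 comes from l^2 <= 4/N: the sub-Gaussian estimate with constant 3/4 is proved
    for l^2 <= 4/17, and 3/4 * 4 is the exponent 3 in the bound for V. The final constant fits
    because 3 + 2q(1+q) = 1 + 2r + 2q^2: concentration consumes 1 + 2r, the -1 pays for the initial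
    distance, and 2q^2 is slack. *)

Lemma expRN_quadratic_nincr {R : realType} (x y : R) : x <= y ->
  (1 + y + y ^+ 2 / 2) * expR (- y) <= (1 + x + x ^+ 2 / 2) * expR (- x).
Proof.
move=> xy.
pose f := (fun y : R => (1 + y + y ^+ 2 / 2) * expR (- y)).
have fd (z : R) : is_derive z (1 : R) f (- (z ^+ 2 / 2) * expR (- z)).
  by apply: is_derive_eq; rewrite /GRing.scale/=; field.
have fc : continuous f.
  by move=> z; apply: differentiable_continuous; apply/derivable1_diffP; have [] := fd z.
apply: (@ler0_derive1_nincr _ f x y) => //.
- move=> z _; rewrite derive1E (@derive_val _ _ _ _ _ _ _ (fd z)).
  by rewrite mulNr oppr_le0 mulr_ge0 ?expR_ge0// divr_ge0// sqr_ge0.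
- exact: continuous_subspaceT.
Qed.

(** The monotone function of [expRN_quadratic_nincr] equals 1 at 0; reading it to the right of 0
    gives this bound, to the left [expR_le1Dxsqr]. *)
Lemma expR_ge1Dxsqr {R : realType} (x : R) : 0 <= x -> 1 + x + x ^+ 2 / 2 <= expR x.
Proof.
move=> /expRN_quadratic_nincr; rewrite oppr0 expR0 expr0n/= mul0r !addr0 mulr1.
by rewrite expRN ler_pdivrMr ?expR_gt0// mul1r.
Qed.

Lemma expR_le1Dxsqr {R : realType} (x : R) : x <= 0 -> expR x <= 1 + x + x ^+ 2 / 2.
Proof.
move=> /expRN_quadratic_nincr; rewrite oppr0 expR0 expr0n/= mul0r !addr0 mulr1.
by rewrite expRN ler_pdivlMr ?expR_gt0// mul1r.
Qed.

(** With 1/3, twice the Taylor coefficient, the polynomial times [expR (- y)] has derivative y^2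
    (1/2 - y/3) [expR (- y)], which is nonnegative exactly up to 3/2. *)
Lemma expR_le1Dxcube {R : realType} (x : R) : 0 <= x <= 3 / 2 ->
  expR x <= 1 + x + x ^+ 2 / 2 + x ^+ 3 / 3.
Proof.
move=> /andP[x0 x32].
pose f := (fun y : R => (1 + y + y ^+ 2 / 2 + y ^+ 3 / 3) * expR (- y)).
have fd (y : R) : is_derive y (1 : R) f ((y ^+ 2 / 2 - y ^+ 3 / 3) * expR (- y)).
  by apply: is_derive_eq; rewrite /GRing.scale/=; field.
have fc : continuous f.
  by move=> y; apply: differentiable_continuous; apply/derivable1_diffP; have [] := fd y.
have : f 0 <= f x.
  apply: (@ger0_derive1_ndecr _ f 0 x) => //.
  - move=> y; rewrite in_itv/= => /andP[y0 yx]; rewrite derive1E (@derive_val _ _ _ _ _ _ _ (fd y)).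
    rewrite mulr_ge0 ?expR_ge0//.
    have -> : y ^+ 2 / 2 - y ^+ 3 / 3 = y ^+ 2 * ((3 / 2 - y) / 3) by field.
    by rewrite mulr_ge0 ?sqr_ge0// divr_ge0// subr_ge0 (le_trans (ltW yx)).
  - exact: continuous_subspaceT.
rewrite /f oppr0 expR0 !expr0n/= !mul0r !addr0 mulr1.
by rewrite expRN ler_pdivlMr ?expR_gt0// mul1r.
Qed.

(** The constants 2/3 and 3/2 match: from x = 3/2 on, 2/3 x^2 dominates x; before it, Taylor-type
    bounds on both sides are compared. *)
Lemma expR_le_sqr {R : realType} (x : R) : expR x <= x + expR (2 / 3 * x ^+ 2).
Proof.
have y0 : 0 <= 2 / 3 * x ^+ 2 by rewrite mulr_ge0// sqr_ge0.
have := expR_ge1Dxsqr y0.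
have [x0|/ltW x0] := leP x 0.
  by have := expR_le1Dxsqr x0; have := sqr_ge0 x; have := sqr_ge0 (2 / 3 * x ^+ 2); lra.
have [x32|x32 _] := leP x (3 / 2).
  have := @expR_le1Dxcube _ x; rewrite x0 x32 => /(_ isT) h1 h2.
  (* The second factor is 2/9 ((x - 3/4)^2 + 3/16). *)
  have : 0 <= x ^+ 2 * (1 / 6 - x / 3 + 2 / 9 * x ^+ 2).
    by rewrite mulr_ge0 ?sqr_ge0//; have := sqr_ge0 (x - 3 / 4); lra.
  lra.
have : expR x <= expR (2 / 3 * x ^+ 2) by rewrite ler_expR; nra.
lra.
Qed.

(** * Measurability of vector-valued maps *)

Definition coord_measurable {d} {T : measurableType d} {R : realType} {n}
    (U : T -> 'rV[R]_n) :=
  forall i, measurable_fun setT (fun t => U t ord0 i).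

Lemma coord_measurable_Vec d (T : measurableType d) (R : realType) n
    (U : T -> 'rV[R]_n) :
  coord_measurable U -> measurable_fun setT (U : T -> Vec R n).
Proof.
move=> mU; apply: (@measurability _ _ T (Vec R n) setT U (@coord_sets R n)) => //.
move=> _ [_ [i [A [mA ->]]] <-].
exact: mU.
Qed.

(** Second countability: an open set is the countable union of the rational cubes it contains, and a
    cube pulls back to finitely many coordinate conditions. *)
Lemma coord_measurable_preimage_open d (T : measurableType d) (R : realType) n
    (U : T -> 'rV[R]_n) (O : set 'rV[R]_n) :
  coord_measurable U -> open O -> measurable (U @^-1` O).
Proof.
move=> mU oO.
pose B (p : 'rV[rat]_n * nat) : set 'rV[R]_n :=
  [set v | forall i, `|v ord0 i - ratr (p.1 ord0 i)| < p.2.+1%:R^-1].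
pose D := [set p | B p `<=` O].
have -> : U @^-1` O = \bigcup_p (if p \in D then U @^-1` B p else set0).
  apply/seteqP; split => [t Ot|t [p _]]; last first.
    by case: ifPn => //; rewrite inE => pD; exact: pD.
  have /nbhs_ballP[e /= e0 eO] := (open_nbhs_nbhs (conj oO Ot) : nbhs (U t) O).
  (* Radius below e/2, so that two points of the same cube are within e of each other. *)
  have [k ke] : exists k : nat, k.+1%:R^-1 < e / 2.
    have /= := near_infty_natSinv_lt (PosNum (divr_gt0 e0 (ltr0n _ 2))).
    by move=> [k _ /(_ k (leqnn _))]; exists k.
  have k0 : 0 < k.+1%:R^-1 :> R by [].
  have qe i : exists q : rat, `|U t ord0 i - ratr q| < k.+1%:R^-1.
    have lu : U t ord0 i - k.+1%:R^-1 < U t ord0 i + k.+1%:R^-1.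
      by rewrite ltrD2l (lt_trans _ k0)// oppr_lt0.
    have [q] := rat_in_itvoo lu.
    by rewrite in_itv/= => /andP[q1 q2]; exists q; rewrite distrC ltr_distl q1.
  pose p := (\row_i projT1 (cid (qe i)), k).
  have tp : B p (U t) by move=> i; rewrite mxE; case: cid.
  exists p => //; rewrite mem_set//= => v vp; apply: eO => /=; split => //.
  move=> a i; rewrite ord1; have := vp i; have := tp i.
  rewrite /ball/=; move: ke; set r := k.+1%:R^-1.
  by rewrite !ltr_norml => ? /andP[? ?] /andP[? ?]; apply/andP; split; lra.
apply: countable_bigcupT_measurable => // p; case: ifP => // _.
have -> : U @^-1` B p = \bigcap_(i in [set: 'I_n])
    [set t | `|U t ord0 i - ratr (p.1 ord0 i)| < p.2.+1%:R^-1].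
  by apply/seteqP; split => [t h i _|t h i]; exact: h.
apply: fin_bigcap_measurable => // i _.
have mf : measurable_fun setT (fun t => `|U t ord0 i - ratr (p.1 ord0 i)|).
  by apply: measurableT_comp => //; apply: measurable_funB => //; exact: mU.
rewrite -[X in measurable X]setTI.
have := mf measurableT `]-oo, (p.2.+1%:R^-1 : R)[%classic (measurable_itv _).
by congr measurable; apply/seteqP; split => t /=; rewrite in_itv.
Qed.

(* Upper semicontinuity is only asked along the range of [U], so [phi] need not
   extend to a semicontinuous function on the whole space. *)
Lemma measurable_usc_along d (T : measurableType d) (R : realType) n
    (U : T -> 'rV[R]_n) (phi : T -> R) :
  coord_measurable U ->
  (forall t c, phi t < c -> exists O : set 'rV[R]_n,
     [/\ open O, O (U t) & forall t', O (U t') -> phi t' < c]) ->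
  measurable_fun setT phi.
Proof.
move=> mU usc; apply: (measurability _ (RGenInftyO.measurableE R)) => //.
move=> _ [_ [c ->] <-]; rewrite setTI.
pose O := \bigcup_(V in [set V : set 'rV[R]_n | open V /\
  forall t', V (U t') -> phi t' < c]) V.
have -> : phi @^-1` `]-oo, c[ = U @^-1` O.
  apply/seteqP; split => t /=; rewrite in_itv/=.
    by move=> /usc[V [oV Vt Vc]]; exists V.
  by move=> [V [oV Vc] /Vc].
apply: coord_measurable_preimage_open => //.
by apply: bigcup_open => V [].
Qed.

(** * Freezing the past of an independent sequence *)

(** Independence on rectangles determines the joint law of [U] and [V] as the product of their laws;
    Tonelli then separates the variables. *)
Lemma integral_indep d dS dX (T : measurableType d) (S : measurableType dS)
    (Xi : measurableType dX) (R : realType) (P : probability T R)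
    (U : T -> S) (V : T -> Xi) (H : S * Xi -> \bar R) :
  measurable_fun setT U -> measurable_fun setT V ->
  (forall A B, measurable A -> measurable B ->
    P (U @^-1` A `&` V @^-1` B) = P (U @^-1` A) * P (V @^-1` B))%E ->
  measurable_fun setT H -> (forall p, 0 <= H p)%E ->
  (\int[P]_t H (U t, V t) = \int[P]_t \int[P]_t' H (U t, V t'))%E.
Proof.
move=> mU mV indep mH H0.
pose UV t := (U t, V t).
have mUV : measurable_fun setT UV by exact: measurable_fun_pair.
pose Uf : {mfun T >-> S} := HB.pack U (isMeasurableFun.Build _ _ _ _ _ mU).
pose Vf : {mfun T >-> Xi} := HB.pack V (isMeasurableFun.Build _ _ _ _ _ mV).
pose UVf : {mfun T >-> (S * Xi)%type} := HB.pack UV (isMeasurableFun.Build _ _ _ _ _ mUV).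
transitivity (\int[distribution P UVf]_p H p)%E.
  by rewrite ge0_integral_distribution.
transitivity (\int[distribution P Uf \x distribution P Vf]_p H p)%E.
  apply: eq_measure_integral => A mA _; apply/esym/product_measure_unique => //.
rewrite (fubini_tonelli1 H mH H0) ge0_integral_distribution//; last 2 first.
- exact: measurable_fun_fubini_tonelli_F.
- by move=> s; apply: integral_ge0.
apply: eq_integral => t _ /=; rewrite /fubini_F ge0_integral_distribution//.
exact: measurableT_comp mH (pair1_measurable _).
Qed.

Lemma same_law_integral d dX (T : measurableType d) (Xi : measurableType dX)
    (R : realType) (P : probability T R) (xi xi' : T -> Xi) (h : Xi -> \bar R) :
  measurable_fun setT xi -> measurable_fun setT xi' -> same_law P xi xi' ->
  measurable_fun setT h -> (forall x, 0 <= h x)%E ->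
  (\int[P]_t h (xi' t) = \int[P]_t h (xi t))%E.
Proof.
move=> mxi mxi' law mh h0.
pose f : {mfun T >-> Xi} := HB.pack xi (isMeasurableFun.Build _ _ _ _ _ mxi).
pose f' : {mfun T >-> Xi} := HB.pack xi' (isMeasurableFun.Build _ _ _ _ _ mxi').
rewrite -(ge0_integral_distribution f mh h0) -(ge0_integral_distribution f' mh h0).
by apply: eq_measure_integral => A mA _; exact: law.
Qed.

(* The pi-system of cylinder events generating the sigma-algebra of
   [xi_1, .., xi_k]. *)
Definition past {T dX} {Xi : measurableType dX} (xis : nat -> T -> Xi) (k : nat) :
    set (set T) :=
  [set E | exists A : nat -> set Xi, (forall j, measurable (A j)) /\
     E = \bigcap_(j in [set j | (0 < j <= k)%N]) (xis j @^-1` A j)].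

Section past.
Context {d dX} {T : measurableType d} {Xi : measurableType dX} {R : realType}.
Variables (P : probability T R) (xis : nat -> T -> Xi).
Hypothesis mxis : forall k, measurable_fun setT (xis k).

Let iota1 k : [set` iota 1 k] = [set j | (0 < j <= k)%N].
Proof. by apply/seteqP; split => j /=; rewrite mem_iota add1n ltnS. Qed.

Let mpre k A : measurable A -> measurable (xis k @^-1` A).
Proof. by move=> mA; rewrite -[X in measurable X]setTI; exact: mxis. Qed.

Lemma past_measurable k : past xis k `<=` measurable.
Proof.
move=> _ [A [mA ->]]; apply: fin_bigcap_measurable => [|j _].
  by rewrite -iota1; exact: finite_seq.
exact: mpre.
Qed.

Lemma sigma_past_measurable k : <<s past xis k >> `<=` measurable.
Proof.
apply: smallest_sub; [exact: sigma_algebra_measurable|exact: past_measurable].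
Qed.

Lemma past_setI_closed k : setI_closed (past xis k).
Proof.
move=> _ _ [A [mA ->]] [B [mB ->]]; exists (fun j => A j `&` B j); split.
  by move=> j; exact: measurableI.
apply/seteqP; split => [t [tA tB] j js|t tAB].
  by split; [exact: tA|exact: tB].
by split => j js; have [] := tAB j js.
Qed.

Lemma past_setT k : past xis k setT.
Proof.
exists (fun=> setT); split => //; apply/seteqP; split => // t _ j _.
Qed.

Lemma sigma_past_mono k : <<s past xis k >> `<=` <<s past xis k.+1 >>.
Proof.
apply: sub_sigma_algebra2 => _ [A [mA ->]].
exists (fun j => if (j <= k)%N then A j else setT); split => [j|].
  by case: ifP.
apply/seteqP; split => t tA j /= /andP[j0 jk].
  by case: ifPn => // {}jk; apply: tA => /=; rewrite j0.
by have := tA j; rewrite /= jk j0 leqW//; exact.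
Qed.

Lemma past_measurable_last k : measurable_fun setT
  (xis k.+1 : g_sigma_algebraType (past xis k.+1) -> Xi).
Proof.
move=> _ A mA; rewrite setTI; apply: sub_sigma_algebra.
exists (fun j => if j == k.+1 then A else setT); split => [j|].
  by case: ifP.
apply/seteqP; split => [t tA j /= _|t /(_ k.+1)].
  by case: ifP => // /eqP ->.
by rewrite /= eqxx; apply; rewrite leqnn.
Qed.

Hypothesis indep : mutually_independent P [set k | (0 < k)%N] xis.

(** For fixed [B] both sides are finite measures in [E], a restriction of [P] and a multiple of [P];
    they agree on the pi-system [past xis k], hence on the sigma-algebra it generates. *)
Lemma past_indep k (E : set T) (B : set Xi) : <<s past xis k >> E -> measurable B ->
  (P (E `&` xis k.+1 @^-1` B) = P E * P (xis k.+1 @^-1` B))%E.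
Proof.
move=> pE mB; have mxB := mpre k.+1 mB.
have r0 : 0 <= fine (P (xis k.+1 @^-1` B)) by rewrite fine_ge0.
have rE : (fine (P (xis k.+1 @^-1` B)))%:E = P (xis k.+1 @^-1` B).
  by rewrite fineK// fin_num_measure.
have -> : (P E * P (xis k.+1 @^-1` B) = mscale (NngNum r0) P E)%E.
  by rewrite /mscale/= rE muleC.
have -> : P (E `&` xis k.+1 @^-1` B) = mrestr P mxB E by [].
apply: (@g_sigma_algebra_measure_unique _ R T (past xis k) (@past_measurable k)
  (fun=> setT)) => //.
- by move=> _; exact: past_setT.
- by apply/seteqP; split => // t _; exists 0%N.
- exact: past_setI_closed.
- move=> _ [A [mA ->]]; rewrite /= /mscale /mrestr /= rE muleC.
  (* Appending [B] as side k.+1 turns the intersection into a single cylinder, to which mutual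
     independence applies. *)
  pose A' j := if j == k.+1 then B else A j.
  have mA' j : measurable (A' j) by rewrite /A'; case: ifP.
  have iotaS : iota 1 k.+1 = rcons (iota 1 k) k.+1 by rewrite -[X in iota 1 X]addn1 iotaD cats1 add1n.
  have sub n : {subset iota 1 n <= [set k | (0 < k)%N]}.
    by move=> j; rewrite mem_iota inE/= => /andP[].
  have -> : \bigcap_(j in [set j | (0 < j <= k)%N]) (xis j @^-1` A j) `&`
      xis k.+1 @^-1` B = \bigcap_(j in [set j | (0 < j <= k.+1)%N]) (xis j @^-1` A' j).
    apply/seteqP; split => [t [tA tB] j /= /andP[j0 jk]|t tA].
      rewrite /A'; have [->//|jk'] := eqVneq j k.+1.
      by apply: tA; rewrite /= j0 -ltnS ltn_neqAle jk'.
    split => [j /= /andP[j0 jk]|].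
      by have := tA j; rewrite /A'/= ltn_eqF// j0 leqW//; exact.
    by have := tA k.+1; rewrite /A'/= eqxx leqnn; exact.
  rewrite -!iota1 (indep (iota_uniq 1 k.+1) (sub k.+1) mA').
  rewrite (indep (iota_uniq 1 k) (sub k) mA) iotaS big_rcons/= /A' eqxx.
  congr (_ * _)%E; apply: eq_big_seq => j.
  by rewrite mem_iota add1n ltnS => /andP[_ jk]; rewrite ltn_eqF.
- by move=> n; rewrite /= /mrestr setTI -rE ltry.
Qed.

Notation psigma k := (g_sigma_algebraType (past xis k)).

Lemma psigma_id_measurable k : measurable_fun setT (idfun : T -> psigma k).
Proof. by move=> _ E mE; rewrite setTI; exact: (@sigma_past_measurable k). Qed.

Lemma psigma_succ_measurable k : measurable_fun setT (idfun : psigma k.+1 -> psigma k).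
Proof. by move=> _ E mE; rewrite setTI; exact: sigma_past_mono. Qed.

Lemma psigma_pair_measurable k :
  measurable_fun setT (fun t : psigma k.+1 => (t : psigma k, xis k.+1 t)).
Proof.
apply: measurable_fun_pair; first exact: psigma_succ_measurable.
exact: past_measurable_last.
Qed.

Variable xi : T -> Xi.
Hypothesis mxi : measurable_fun setT xi.
Hypothesis law : forall k, (0 < k)%N -> same_law P xi (xis k).

(* Since [t |-> t] is measurable from [T] to [psigma k], the past is integrated
   as a single variable, independent of [xis k.+1]. *)
Lemma integral_freeze k (H : psigma k * Xi -> \bar R) :
  measurable_fun setT H -> (forall p, 0 <= H p)%E ->
  (\int[P]_t H (t, xis k.+1 t) = \int[P]_t \int[P]_t' H (t, xi t'))%E.
Proof.
move=> mH H0.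
rewrite (integral_indep (psigma_id_measurable (k := k)) (mxis k.+1) _ mH H0); last first.
  by move=> A B mA mB; exact: past_indep.
apply: eq_integral => t _.
rewrite (same_law_integral (P := P) mxi (mxis k.+1) (law _) _ _ (h := fun x => H (t, x)))//.
exact: measurableT_comp mH (pair1_measurable _).
Qed.

Section product.
Variable H : forall k, psigma k -> Xi -> R.
Hypothesis mH : forall k, measurable_fun setT (fun p : psigma k * Xi => H p.1 p.2).
Hypothesis H0 : forall k t x, 0 <= @H k t x.

Lemma measurable_prod_past N :
  measurable_fun setT (fun t : psigma N => \prod_(k < N) @H k t (xis k.+1 t)).
Proof.
elim: N => [|N IH].
  by under eq_fun do rewrite big_ord0; exact: measurable_cst.
under eq_fun do rewrite big_ord_recr/=.
apply: measurable_funM.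
  exact: measurableT_comp IH (psigma_succ_measurable (k := N)).
exact: (measurableT_comp (mH (k := N)) (psigma_pair_measurable (k := N))).
Qed.

(** Replaces the tower property of conditional expectation: with the first N samples frozen, the
    last factor integrates to at most [C] whatever the past, and induction handles the rest. *)
Lemma integral_prod_past (C : R) N :
  (forall k t, \int[P]_t' (@H k t (xi t'))%:E <= C%:E)%E ->
  (\int[P]_t (\prod_(k < N) @H k t (xis k.+1 t))%:E <= (C ^+ N)%:E)%E.
Proof.
move=> HC.
have C0 : 0 <= C.
  rewrite -lee_fin (le_trans _ (HC 0%N point))//.
  by apply: integral_ge0 => t _; rewrite lee_fin.
elim: N => [|N IH].
  under eq_integral do rewrite big_ord0.
  by rewrite integral_cst//= probability_setT expr0 mule1.
under eq_integral do rewrite big_ord_recr/=.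
pose K (p : psigma N * Xi) := ((\prod_(k < N) @H k p.1 (xis k.+1 p.1)) * @H N p.1 p.2)%:E.
have W0 t : 0 <= \prod_(k < N) @H k t (xis k.+1 t) by apply: prodr_ge0 => k _.
have mW := measurable_prod_past (N := N).
rewrite (@integral_freeze N K); last 2 first.
- apply/measurable_EFinP; apply: measurable_funM; last exact: mH.
  exact: measurableT_comp mW measurable_fst.
- by move=> p; rewrite lee_fin mulr_ge0.
have mWT : measurable_fun setT (fun t : T => \prod_(k < N) @H k t (xis k.+1 t)).
  exact: measurableT_comp mW (psigma_id_measurable (k := N)).
apply: (@le_trans _ _ (\int[P]_t (C%:E * (\prod_(k < N) @H k t (xis k.+1 t))%:E))%E).
  apply: ge0_le_integral => //.
  - by move=> t _; apply: integral_ge0 => t' _; rewrite lee_fin mulr_ge0.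
  - have mK : measurable_fun setT (fun p : T * T => K (p.1, xi p.2)).
      apply/measurable_EFinP; apply: measurable_funM.
        exact: measurableT_comp mWT measurable_fst.
      apply: (measurableT_comp (mH (k := N))); apply: measurable_fun_pair.
        exact: measurableT_comp (psigma_id_measurable (k := N)) measurable_fst.
      exact: measurableT_comp mxi measurable_snd.
    apply: (measurable_fun_fubini_tonelli_F (m2 := P) _ mK) => p.
    by rewrite lee_fin mulr_ge0.
  - by apply/measurable_EFinP; apply: measurable_funM.
  - move=> t _; rewrite /K/=.
    under eq_integral do rewrite EFinM.
    rewrite ge0_integralZl//; last 3 first.
    + apply/measurable_EFinP.
      have mHt := measurableT_comp (mH (k := N)) (pair1_measurable (t : psigma N)).
      exact: (measurableT_comp mHt mxi).
    + by move=> t' _; rewrite lee_fin.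
    + by rewrite lee_fin.
    by rewrite muleC lee_wpmul2r// lee_fin.
rewrite ge0_integralZl_EFin//; last 2 first.
- by move=> t _; rewrite lee_fin.
- exact/measurable_EFinP.
by rewrite exprS EFinM lee_wpmul2l// lee_fin.
Qed.
End product.

End past.

(** * Exponential moments *)

(** Average the tangent-line bounds at the mean point, taken at [a] and [b]. *)
Lemma expR_convex {R : realType} (t a b : R) : 0 <= t <= 1 ->
  expR (t * a + (1 - t) * b) <= t * expR a + (1 - t) * expR b.
Proof.
move=> /andP[t0 t1]; set m := t * a + (1 - t) * b.
have tangent c : expR m * (1 + (c - m)) <= expR c.
  have {2}-> : c = m + (c - m) by ring.
  by rewrite (expRD m) ler_wpM2l ?expR_ge0// expR_ge1Dx.
have -> : expR m = t * (expR m * (1 + (a - m))) + (1 - t) * (expR m * (1 + (b - m))).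
  by rewrite /m; ring.
by rewrite lerD// ler_wpM2l// subr_ge0.
Qed.

Section exponential_moments.
Context {d} {T : measurableType d} {R : realType} (P : probability T R).

Let measurable_expR_comp (Y : T -> R) : measurable_fun setT Y ->
  measurable_fun setT (fun t => expR (Y t)).
Proof. by move=> mY; apply: (measurableT_comp _ mY); exact: measurable_expR. Qed.

(** Convexity of [expR] between Y - 1 and 0 gives an affine majorant in [expR (Y t)], whose integral
    is at most [expR k]; this stands in for Jensen's inequality for a concave power. *)
Lemma expR_moment_scale (Y : T -> R) (k : R) : 0 <= k <= 1 ->
  measurable_fun setT Y -> (\int[P]_t (expR (Y t))%:E <= (expR 1)%:E)%E ->
  (\int[P]_t (expR (k * Y t))%:E <= (expR k)%:E)%E.
Proof.
move=> k01 mY Y1; have /andP[k0 k1] := k01.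
apply: (@le_trans _ _ (\int[P]_t (expR k * (1 - k) + expR k * k * expR (-1) * expR (Y t))%:E)%E).
  apply: ge0_le_integral => [//|t _|||t _].
  - by rewrite lee_fin expR_ge0.
  - by apply/measurable_EFinP/measurable_expR_comp/measurable_funM.
  - apply/measurable_EFinP; apply: measurable_funD => //.
    by apply: measurable_funM => //; exact: measurable_expR_comp.
  - rewrite lee_fin.
    have := expR_convex (Y t - 1) 0 k01; rewrite expR0 mulr0 addr0 !mulr1 expRD => h.
    have -> : k * Y t = k + k * (Y t - 1) by ring.
    rewrite expRD; apply: (le_trans (ler_wpM2l (expR_ge0 k) h)).
    by rewrite le_eqVlt; apply/orP; left; apply/eqP; ring.
under eq_integral do rewrite EFinD.
rewrite ge0_integralD//=; last 3 first.
- by move=> t _; rewrite lee_fin mulr_ge0 ?expR_ge0// subr_ge0.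
- by move=> t _; rewrite lee_fin !mulr_ge0 ?expR_ge0.
- by apply/measurable_EFinP/measurable_funM => //; exact: measurable_expR_comp.
rewrite integral_cst//= probability_setT mule1.
under eq_integral do rewrite EFinM.
rewrite (ge0_integralZl_EFin _ measurableT); last 3 first.
- by move=> t _; rewrite lee_fin expR_ge0.
- by apply/measurable_EFinP; exact: measurable_expR_comp.
- by rewrite !mulr_ge0 ?expR_ge0.
have c0 : 0 <= expR k * k * expR (-1) :> R by rewrite !mulr_ge0 ?expR_ge0.
apply: (@le_trans _ _ ((expR k * (1 - k))%:E + (expR k * k * expR (-1))%:E * (expR 1)%:E)%E).
  by rewrite leeD2l// lee_wpmul2l// lee_fin.
rewrite -EFinM -EFinD lee_fin -(mulrA _ (expR (-1))) -expRD addNr expR0 mulr1.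
by rewrite -mulrDr subrK mulr1.
Qed.

(** Integrate u <= exp(u - 1) at u = Y^2. *)
Lemma sqr_moment_le1 (Y : T -> R) :
  measurable_fun setT Y -> (\int[P]_t (expR (Y t ^+ 2))%:E <= (expR 1)%:E)%E ->
  (\int[P]_t (Y t ^+ 2)%:E <= 1)%E.
Proof.
move=> mY Y1.
have mY2 : measurable_fun setT (fun t => Y t ^+ 2) by exact: measurable_funX.
apply: (@le_trans _ _ (\int[P]_t ((expR (-1))%:E * (expR (Y t ^+ 2))%:E))%E).
  apply: ge0_le_integral => [//|t _|||t _].
  - by rewrite lee_fin sqr_ge0.
  - exact/measurable_EFinP.
  - apply/measurable_EFinP; apply: measurable_funM => //.
    exact: measurable_expR_comp.
  - rewrite lee_fin -expRD.
    by have := expR_ge1Dx (- 1 + Y t ^+ 2); rewrite addrA subrr add0r.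
rewrite (ge0_integralZl_EFin _ measurableT) ?expR_ge0//; last first.
- by apply/measurable_EFinP; exact: measurable_expR_comp.
apply: (@le_trans _ _ ((expR (-1))%:E * (expR 1)%:E)%E).
  by rewrite lee_wpmul2l// lee_fin expR_ge0.
by rewrite -EFinM -expRD addNr expR0.
Qed.

(* [expR x <= x + expR (2/3 x^2)] absorbs the mean before the square is
   rescaled, so [Y] need not be centered in the hypothesis. *)
Lemma subgaussian_moment (Y : T -> R) (mu l : R) :
  measurable_fun setT Y -> P.-integrable setT (EFin \o Y) ->
  (\int[P]_t (Y t)%:E = mu%:E)%E ->
  (\int[P]_t (expR (Y t ^+ 2))%:E <= (expR 1)%:E)%E -> l ^+ 2 <= 4 / 17 ->
  (\int[P]_t (expR (l * (Y t - mu)))%:E <= (expR (3 / 4 * l ^+ 2))%:E)%E.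
Proof.
move=> mY iY Ymu Y1 l17; set k := 2 / 3 * l ^+ 2.
have l0 := sqr_ge0 l.
have k0 : 0 <= k <= 1 by rewrite /k; lra.
have mY2 : measurable_fun setT (fun t => Y t ^+ 2) by exact: measurable_funX.
have Yk := expR_moment_scale k0 mY2 Y1.
have mE : measurable_fun setT (fun t => expR (k * Y t ^+ 2)).
  by apply/measurable_expR_comp/measurable_funM.
have iE : P.-integrable setT (EFin \o (fun t => expR (k * Y t ^+ 2))).
  apply/integrableP; split; first exact/measurable_EFinP.
  under eq_integral do rewrite /= ger0_norm ?expR_ge0//.
  by rewrite (le_lt_trans Yk)// ltry.
have ilY : P.-integrable setT (fun t => l%:E * (Y t)%:E)%E by exact: integrableZl.
apply: (@le_trans _ _ (\int[P]_t ((expR (- (l * mu)))%:E *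
    (l%:E * (Y t)%:E + (expR (k * Y t ^+ 2))%:E)))%E).
  apply: ge0_le_integral => [//|t _|||t _].
  - by rewrite lee_fin expR_ge0.
  - by apply/measurable_EFinP/measurable_expR_comp/measurable_funM => //;
      apply: measurable_funB.
  - apply/measurable_EFinP/measurable_funM => //; apply: measurable_funD => //.
    exact: measurable_funM.
  - rewrite lee_fin (_ : l * (Y t - mu) = - (l * mu) + l * Y t); last by ring.
    rewrite expRD ler_wpM2l ?expR_ge0//.
    have := expR_le_sqr (l * Y t).
    by rewrite exprMn mulrA.
rewrite integralZl//; last exact: integrableD.
rewrite integralD//= integralZl// Ymu.
apply: (@le_trans _ _ ((expR (- (l * mu)))%:E * ((l * mu)%:E + (expR k)%:E))%E).
  by rewrite lee_wpmul2l ?lee_fin ?expR_ge0// -EFinM leeD2l.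
rewrite -EFinD -EFinM lee_fin.
(* Since k <= 8/51, the higher-order terms cost at most k/8, and 9/8 * 2/3 = 3/4. *)
have kk : expR k - 1 <= 3 / 4 * l ^+ 2.
  have := @expR_le1Dxcube _ k; have -> : 0 <= k <= 3 / 2 by lra.
  move=> /(_ isT) h.
  have : k ^+ 2 / 2 + k ^+ 3 / 3 <= k * (1 / 8).
    have kle : k <= 8 / 51 by rewrite /k; lra.
    have : 0 <= k * (1 / 8 - k / 2 - k ^+ 2 / 3) by rewrite mulr_ge0//; nra.
    lra.
  rewrite /k in h *; lra.
(* Exponentiating l mu + exp k lets the factor exp(- l mu) remove the mean, leaving exp(exp k -
   1). *)
have h := expR_ge1Dx (l * mu + expR k - 1).
apply: (@le_trans _ _ (expR (- (l * mu)) * expR (l * mu + expR k - 1))).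
  by rewrite ler_wpM2l ?expR_ge0//; lra.
by rewrite -expRD ler_expR; lra.
Qed.

End exponential_moments.

(** * Proximal steps and the Moreau envelope *)

Section dot.
Context {R : realType} {n : nat}.
Implicit Types u v w : 'rV[R]_n.

Lemma dotvC u v : dotv u v = dotv v u.
Proof. by apply: eq_bigr => i _; rewrite mulrC. Qed.

Lemma dotvDl u v w : dotv (u + v) w = dotv u w + dotv v w.
Proof. by rewrite /dotv -big_split; apply: eq_bigr => i _; rewrite !mxE mulrDl. Qed.

Lemma dotvZl a u v : dotv (a *: u) v = a * dotv u v.
Proof. by rewrite /dotv mulr_sumr; apply: eq_bigr => i _; rewrite !mxE mulrA. Qed.

Lemma dotvNl u v : dotv (- u) v = - dotv u v.
Proof. by rewrite -scaleN1r dotvZl mulN1r. Qed.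

Lemma dotvDr u v w : dotv w (u + v) = dotv w u + dotv w v.
Proof. by rewrite !(dotvC w) dotvDl. Qed.

Lemma dotvZr a u v : dotv v (a *: u) = a * dotv v u.
Proof. by rewrite !(dotvC v) dotvZl. Qed.

Lemma dotvNr u v : dotv v (- u) = - dotv v u.
Proof. by rewrite !(dotvC v) dotvNl. Qed.

Definition dotvE := (dotvDl, dotvDr, dotvNl, dotvNr, dotvZl, dotvZr).

Lemma dotv_ge0 u : 0 <= dotv u u.
Proof. by apply: sumr_ge0 => i _; rewrite -expr2 sqr_ge0. Qed.

Lemma enorm_sqr u : enorm u ^+ 2 = dotv u u.
Proof. by rewrite sqr_sqrtr// dotv_ge0. Qed.

Lemma continuous_dotv_sub w : continuous (fun u => dotv (w - u) (w - u)).
Proof.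
apply: continuous_big => [|i _ u]; first exact: add_continuous.
have ci : continuous (fun u : 'rV[R]_n => (w - u) ord0 i).
  have -> : (fun u : 'rV[R]_n => (w - u) ord0 i) = (fun u => w ord0 i - u ord0 i).
    by apply/funext => v; rewrite !mxE.
  move=> v; apply: continuousB; last exact: coord_continuous.
  exact: cst_continuous.
exact: cvgM (ci u) (ci u).
Qed.

Lemma open_dotv_lt w (c : R) : open [set u | dotv (w - u) (w - u) < c].
Proof.
apply: (@open_comp _ _ (fun u => dotv (w - u) (w - u)) [set x | x < c]).
  by move=> u _; exact: continuous_dotv_sub.
exact: open_lt.
Qed.

End dot.

Section prox.
Context {R : realType} {n : nat}.
Variables (h : 'rV[R]_n -> \bar R) (gamma : R).
Hypothesis h_proper : proper_fun h.
Hypothesis gamma0 : 0 < gamma.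
Implicit Types u v w x p G : 'rV[R]_n.

Lemma edom_fineK x : edom h x -> (fine (h x))%:E = h x.
Proof. by move=> hx; rewrite fineK// fin_numE -ltey -ltNye hx andbT; case: h_proper. Qed.

Lemma esubdiff_le x v w : esubdiff h x v -> edom h x -> edom h w ->
  fine (h x) + dotv v (w - x) <= fine (h w).
Proof. by move=> /(_ w) + dx dw; rewrite -(edom_fineK dx) -(edom_fineK dw). Qed.

Lemma is_prox_edom u p : is_prox h gamma u p -> edom h p.
Proof.
move=> prox; have [hN [w dw]] := h_proper; have := prox w.
rewrite -(edom_fineK dw) /edom/= => le1.
by move: le1 (hN p); case: (h p).
Qed.

Lemma is_prox_le u p w : is_prox h gamma u p -> edom h w ->
  fine (h p) + dotv (p - u) (p - u) / (2 * gamma) <=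
  fine (h w) + dotv (w - u) (w - u) / (2 * gamma).
Proof.
move=> prox dw; have dp := is_prox_edom prox; have := prox w.
by rewrite -(edom_fineK dw) -(edom_fineK dp) !enorm_sqr.
Qed.

Lemma edom_convex x w l : econvex h -> 0 < l < 1 -> edom h x -> edom h w ->
  edom h (l *: x + (1 - l) *: w) /\
  fine (h (l *: x + (1 - l) *: w)) <= l * fine (h x) + (1 - l) * fine (h w).
Proof.
move=> cvx l01 dx dw; have := cvx x w l l01.
rewrite -(edom_fineK dx) -(edom_fineK dw) -!EFinM -EFinD => le1.
have d : edom h (l *: x + (1 - l) *: w) by rewrite /edom/= (le_lt_trans le1)// ltry.
by split => //; move: le1; rewrite -(edom_fineK d).
Qed.

(** Compare [p] with l w + (1 - l) p, divide by l, and let l tend to 0. *)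
Lemma is_prox_strong u p w : econvex h -> is_prox h gamma u p -> edom h w ->
  fine (h p) + dotv (p - u) (p - u) / (2 * gamma) + dotv (w - p) (w - p) / (2 * gamma) <=
  fine (h w) + dotv (w - u) (w - u) / (2 * gamma).
Proof.
move=> cvx prox dw; have dp := is_prox_edom prox.
set a := fine (h w) + _; set b := fine (h p) + _; set c := _ / (2 * gamma).
have c0 : 0 <= c by rewrite divr_ge0 ?dotv_ge0// mulr_ge0// ltW.
suff lim l : 0 < l < 1 -> b + (1 - l) * c <= a.
  apply/ler_addgt0Pr => e e0.
  have [ce|ec] := leP c e.
    by have := lim (1 / 2); rewrite divr_gt0//= => /(_ (ltac:(lra))); lra.
  have cpos : 0 < c by rewrite (lt_trans e0).
  (* This l loses exactly l c = e. *)
  have l1 : 0 < e / c < 1 by rewrite divr_gt0//= ltr_pdivrMr// mul1r.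
  have := lim _ l1; rewrite mulrBl mul1r divfK ?gt_eqF//; lra.
move=> l01; have /andP[l0 l1] := l01.
have [dl hl] := edom_convex cvx l01 dw dp.
have := is_prox_le prox dl.
have -> : dotv (l *: w + (1 - l) *: p - u) (l *: w + (1 - l) *: p - u) =
    l * dotv (w - u) (w - u) + (1 - l) * dotv (p - u) (p - u) -
    l * (1 - l) * dotv (w - p) (w - p).
  rewrite !dotvE (dotvC p w) (dotvC u w) (dotvC u p); ring.
move=> le1.
have : l * (b + (1 - l) * c) <= l * a by rewrite /a /b /c in le1 *; nra.
by rewrite ler_pM2l.
Qed.

(** The infimum runs over [edom h] because [fine] would turn the value +oo into 0 elsewhere. *)
Definition moreau_env u : R :=
  inf [set fine (h w) + dotv (w - u) (w - u) / (2 * gamma) | w in edom h].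

(** Insert the subgradient inequality at [x] and complete the square: what remains is |w - x + gamma
    (v + G)|^2 / (2 gamma). *)
Lemma moreau_lb x v G w : esubdiff h x v -> edom h x -> edom h w ->
  fine (h x) + gamma / 2 * dotv G G - gamma / 2 * dotv (v + G) (v + G) <=
  fine (h w) + dotv (w - (x - gamma *: G)) (w - (x - gamma *: G)) / (2 * gamma).
Proof.
move=> hv dx dw; have := esubdiff_le hv dx dw.
have g0 : gamma != 0 by rewrite gt_eqF.
have -> : dotv (w - (x - gamma *: G)) (w - (x - gamma *: G)) / (2 * gamma) =
   dotv (w - x + gamma *: (v + G)) (w - x + gamma *: (v + G)) / (2 * gamma)
   - dotv v (w - x) + gamma / 2 * dotv G G - gamma / 2 * dotv (v + G) (v + G).
  rewrite !dotvE (dotvC w x) (dotvC G w) (dotvC G x) (dotvC v w) (dotvC v x) (dotvC v G).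
  by field.
have : 0 <= dotv (w - x + gamma *: (v + G)) (w - x + gamma *: (v + G)) / (2 * gamma).
  by rewrite divr_ge0 ?dotv_ge0// mulr_ge0// ltW.
lra.
Qed.

Section env.
Variables (x0 v0 : 'rV[R]_n).
Hypothesis (dx0 : edom h x0) (hv0 : esubdiff h x0 v0).

Lemma has_inf_moreau u :
  has_inf [set fine (h w) + dotv (w - u) (w - u) / (2 * gamma) | w in edom h].
Proof.
split; first by exists (fine (h x0) + dotv (x0 - u) (x0 - u) / (2 * gamma)); exists x0.
(* Every [u] is a gradient step from [x0] for this [G], so [moreau_lb] bounds the set below. *)
pose G := gamma^-1 *: (x0 - u).
have uE : u = x0 - gamma *: G.
  by rewrite scalerA divff ?gt_eqF// scale1r opprB addrC subrK.
exists (fine (h x0) + gamma / 2 * dotv G G - gamma / 2 * dotv (v0 + G) (v0 + G)).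
by move=> _ [w dw <-]; have := moreau_lb G hv0 dx0 dw; rewrite -uE.
Qed.

Lemma moreau_env_le u w : edom h w ->
  moreau_env u <= fine (h w) + dotv (w - u) (w - u) / (2 * gamma).
Proof. by move=> dw; apply: ge_inf; [case: (has_inf_moreau u)|exists w]. Qed.

(** An infimum of continuous functions is upper semicontinuous: a [w] that beats c at [U t] still
    does so nearby. *)
Lemma moreau_env_measurable d (T : measurableType d) (U : T -> 'rV[R]_n) :
  coord_measurable U -> measurable_fun setT (fun t => moreau_env (U t)).
Proof.
move=> mU; apply: (measurable_usc_along mU) => t c /(inf_lt (has_inf_moreau _).1).
move=> [_ [w dw <-] ltc].
exists [set u | dotv (w - u) (w - u) < (c - fine (h w)) * (2 * gamma)].
have E u : (fine (h w) + dotv (w - u) (w - u) / (2 * gamma) < c) =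
    (dotv (w - u) (w - u) < (c - fine (h w)) * (2 * gamma)).
  by rewrite -ltr_pdivrMr ?mulr_gt0// ltrBrDl.
split => /= [||t' ltc']; first exact: open_dotv_lt.
- by rewrite -E.
- by rewrite (le_lt_trans (moreau_env_le _ dw))// E.
Qed.

End env.

(** The suboptimality of staying at [x] in the proximal subproblem centred at x - gamma G, where the
    quadratic term equals gamma/2 |G|^2. *)
Definition moreau_gap x G : R :=
  fine (h x) + gamma / 2 * dotv G G - moreau_env (x - gamma *: G).

Lemma moreau_gap_ge0 x v G : edom h x -> esubdiff h x v -> 0 <= moreau_gap x G.
Proof.
move=> dx hv; rewrite subr_ge0 (le_trans (moreau_env_le dx hv _ dx))//.
have -> : x - (x - gamma *: G) = gamma *: G by rewrite opprB addrC subrK.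
rewrite lerD2l !dotvE le_eqVlt; apply/orP; left; apply/eqP.
by field; rewrite gt_eqF.
Qed.

Lemma moreau_gap_le x v G : edom h x -> esubdiff h x v ->
  moreau_gap x G <= gamma / 2 * dotv (v + G) (v + G).
Proof.
move=> dx hv; rewrite /moreau_gap lerBlDr -lerBlDl.
apply: lb_le_inf; first by case: (has_inf_moreau dx hv (x - gamma *: G)).
by move=> _ [w dw <-]; exact: moreau_lb.
Qed.

(** The envelope bounds the subproblem value at [p] from below, [is_prox_strong] bounds it from
    above; expanding the square at [w] produces the term in [G]. *)
Lemma prox_step x v G p w : econvex h -> edom h x -> esubdiff h x v ->
  is_prox h gamma (x - gamma *: G) p -> edom h w ->
  fine (h x) - fine (h w) + dotv G (x - w) <=
  (dotv (x - w) (x - w) - dotv (p - w) (p - w)) / (2 * gamma) + moreau_gap x G.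
Proof.
move=> cvx dx hv prox dw.
have g0 : gamma != 0 by rewrite gt_eqF.
have := is_prox_strong cvx prox dw.
have := moreau_env_le dx hv (x - gamma *: G) (is_prox_edom prox).
rewrite /moreau_gap.
have -> : dotv (w - (x - gamma *: G)) (w - (x - gamma *: G)) / (2 * gamma) =
  dotv (x - w) (x - w) / (2 * gamma) - dotv G (x - w) + gamma / 2 * dotv G G.
  by rewrite !dotvE (dotvC w x) (dotvC G w) (dotvC G x); field.
have -> : dotv (p - w) (p - w) = dotv (w - p) (w - p).
  by rewrite !dotvE (dotvC w p); ring.
rewrite mulrBl; lra.
Qed.

End prox.

(** * Concentration *)

Section concentration.
Context {d dX} {T : measurableType d} {Xi : measurableType dX} {R : realType}.
Variables (P : probability T R) (xis : nat -> T -> Xi) (xi : T -> Xi).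
Hypothesis mxis : forall k, measurable_fun setT (xis k).
Hypothesis indep : mutually_independent P [set k | (0 < k)%N] xis.
Hypothesis mxi : measurable_fun setT xi.
Hypothesis law : forall k, (0 < k)%N -> same_law P xi (xis k).

Notation psigma k := (g_sigma_algebraType (past xis k)).

(** Adding [B] makes the integrand nonnegative, so that Tonelli gives measurability in the
    parameter; [B] is then subtracted. *)
Lemma measurable_mean k (b : psigma k -> Xi -> R) (B : R) :
  measurable_fun setT (fun p : psigma k * Xi => b p.1 p.2) ->
  (forall t x, `|b t x| <= B) ->
  measurable_fun setT (fun t : psigma k => \int[P]_t' b t (xi t')).
Proof.
move=> mb bB.
have mbxi : measurable_fun setT (fun p : psigma k * T => b p.1 (xi p.2)).
  apply: (measurableT_comp (g := fun p : psigma k * T => (p.1, xi p.2)) mb).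
  apply: measurable_fun_pair; first exact: measurable_fst.
  exact: measurableT_comp mxi measurable_snd.
have B0 t : measurable_fun setT (fun t' => b t (xi t')).
  exact: (measurableT_comp mbxi (pair1_measurable t)).
have ib t : P.-integrable setT (EFin \o (fun t' => b t (xi t'))).
  apply: (@le_integrable _ _ _ _ _ measurableT _ (EFin \o cst B)).
  - exact/measurable_EFinP.
  - by move=> t' _ /=; rewrite lee_fin (le_trans (bB _ _))// ler_norm.
  - exact: finite_measure_integrable_cst.
have -> : (fun t : psigma k => \int[P]_t' b t (xi t')) =
    (fun t => fine (\int[P]_t' (b t (xi t') + B)%:E) - B).
  apply/funext => t; rewrite /Rintegral.
  under [X in _ = fine X - _]eq_integral do rewrite EFinD.
  rewrite (integralD _ (ib t))//=; last exact: finite_measure_integrable_cst.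
  rewrite integral_cst//= probability_setT mule1.
  by rewrite [in RHS](fineD (integrable_fin_num measurableT (ib t)))//= addrK.
apply: measurable_funB => //; apply: (measurableT_comp (fine_measurable measurableT)).
apply: (measurable_fun_fubini_tonelli_F (m2 := P)
  (fun p : psigma k * T => (b p.1 (xi p.2) + B)%:E)) => [|p].
  by apply/measurable_EFinP; exact: measurable_funD.
by rewrite lee_fin -lerBlDr sub0r; have := bB p.1 (xi p.2); rewrite ler_norml => /andP[].
Qed.

Variables (s b : forall k, psigma k -> Xi -> R) (B : R).
Hypothesis ms : forall k, measurable_fun setT (fun p : psigma k * Xi => s p.1 p.2).
Hypothesis mb : forall k, measurable_fun setT (fun p : psigma k * Xi => b p.1 p.2).
Hypothesis bB : forall k t x, `|@b k t x| <= B.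
Hypothesis s_exp : forall k t,
  (\int[P]_t' (expR (@s k t (xi t')))%:E <= (expR 1)%:E)%E.
Hypothesis b_exp : forall k t, exists c,
  (\int[P]_t' (expR ((@b k t (xi t') + c) ^+ 2))%:E <= (expR 1)%:E)%E.

Let measurable_section k (g : psigma k -> Xi -> R) (t : psigma k) :
  measurable_fun setT (fun p : psigma k * Xi => g p.1 p.2) ->
  measurable_fun setT (fun t' => g t (xi t')).
Proof.
by move=> mg; exact: (measurableT_comp (measurableT_comp mg (pair1_measurable t)) mxi).
Qed.

Let measurable_expR_comp d' (S : measurableType d') (Y : S -> R) :
  measurable_fun setT Y -> measurable_fun setT (fun t => expR (Y t)).
Proof. by move=> mY; apply: (measurableT_comp _ mY); exact: measurable_expR. Qed.

Let mean k (t : psigma k) := \int[P]_t' b t (xi t').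

Let mmean k : measurable_fun setT (@mean k).
Proof. exact: (measurable_mean (@mb k) (@bB k)). Qed.

(** Each of the N factors contributes at most exp(1/N), by [expR_moment_scale]. *)
Lemma exp_sum_le N : (0 < N)%N ->
  (\int[P]_t (expR (N%:R^-1 * \sum_(k < N) @s k t (xis k.+1 t)))%:E <= (expR 1)%:E)%E.
Proof.
move=> N0; have N0' : 0 < N%:R :> R by rewrite ltr0n.
pose H k (t : psigma k) (x : Xi) := expR (N%:R^-1 * s t x).
under eq_integral do rewrite mulr_sumr expR_sum.
have -> : expR 1 = expR N%:R^-1 ^+ N :> R by rewrite -expRM_natl divff ?gt_eqF.
apply: (integral_prod_past mxis indep mxi law (H := H)) => [k|k t x|k t].
- by apply/measurable_expR_comp/measurable_funM => //; exact: ms.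
- exact: expR_ge0.
- apply: expR_moment_scale => //; last exact: measurable_section.
  by rewrite invr_ge0 ler0n invf_le1// ler1n.
Qed.

Lemma exp_deviation_le N (l : R) : l ^+ 2 <= 4 / 17 ->
  (\int[P]_t (expR (\sum_(k < N) l * (mean (t : psigma k) - b (t : psigma k) (xis k.+1 t))))%:E
    <= (expR (3 / 4 * l ^+ 2) ^+ N)%:E)%E.
Proof.
move=> l17.
pose H k (t : psigma k) (x : Xi) := expR (l * (mean t - b t x)).
under eq_integral do rewrite expR_sum.
apply: (integral_prod_past mxis indep mxi law (H := H)) => [k|k t x|k t].
- apply/measurable_expR_comp/measurable_funM => //; apply: measurable_funB; last exact: mb.
  exact: measurableT_comp (mmean (k := k)) measurable_fst.
- exact: expR_ge0.
- have mbt := measurable_section t (@mb k).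
  have ib : P.-integrable setT (EFin \o (fun t' => b t (xi t'))).
    apply: (@le_integrable _ _ _ _ _ measurableT _ (EFin \o cst B)).
    - exact/measurable_EFinP.
    - by move=> t' _ /=; rewrite lee_fin (le_trans (bB _ _))// ler_norm.
    - exact: finite_measure_integrable_cst.
  have [c bc] := b_exp t.
  (* The shift c cancels in the centred difference; exchanging mean and sample turns l into - l. *)
  have -> : (fun t' => (H k t (xi t'))%:E) =
      (fun t' => (expR (- l * (b t (xi t') + c - (mean t + c))))%:E).
    by apply/funext => t'; rewrite /H; congr (expR _)%:E; ring.
  have ic : P.-integrable setT (EFin \o cst c) by exact: finite_measure_integrable_cst.
  rewrite -(sqrrN l); apply: subgaussian_moment => //; last by rewrite sqrrN.
  + exact: measurable_funD.
  + by have := integrableD measurableT ib ic.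
  under eq_integral do rewrite EFinD.
  rewrite (integralD _ ib ic)//= integral_cst//= probability_setT mule1 EFinD.
  by rewrite /mean /Rintegral fineK//; exact: (integrable_fin_num measurableT ib).
Qed.

(* Convexity of [expR] with weights [1/(1+r)] and [r/(1+r)] bounds the joint
   exponential moment without independence of the two sums; the final comparison
   is tight at [r = 1], [Om = 4] and uses [expR (1/2) <= 2]. *)
Lemma concentration N (l r Om : R) (A : set T) :
  (16 < N)%N -> l ^+ 2 <= 4 / N%:R -> 1 <= r -> 4 < Om -> measurable A ->
  (forall t, A t -> (1 + 2 * r) * Om - 1 <=
     N%:R^-1 * \sum_(k < N) @s k t (xis k.+1 t) +
     r * \sum_(k < N) l * (mean (t : psigma k) - b (t : psigma k) (xis k.+1 t))) ->
  (P A <= (2 * expR (- Om))%:E)%E.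
Proof.
move=> N16 lN r1 Om4 mA AE.
pose S (t : T) := N%:R^-1 * \sum_(k < N) @s k t (xis k.+1 t).
pose V (t : T) := \sum_(k < N) l * (mean (t : psigma k) - b (t : psigma k) (xis k.+1 t)).
have {}AE t : A t -> (1 + 2 * r) * Om - 1 <= S t + r * V t by exact: AE.
have N0 : 0 < N%:R :> R by rewrite ltr0n (leq_trans _ N16).
have N17 : 17 <= N%:R :> R by rewrite (ler_nat _ 17 N).
have l17 : l ^+ 2 <= 4 / 17.
  by rewrite (le_trans lN)// ler_pM2l// lef_pV2 ?posrE.
have ES := exp_sum_le (leq_trans (isT : (0 < 17)%N) N16).
(* From l^2 <= 4/N, the total exponent 3/4 l^2 N is at most 3. *)
have EV : (\int[P]_t (expR (V t))%:E <= (expR 3)%:E)%E.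
  apply: (le_trans (exp_deviation_le N l17)).
  rewrite lee_fin -expRM_natl ler_expR.
  by move: lN; rewrite ler_pdivlMr// => lN; nra.
have mterm (g : forall k, psigma k -> Xi -> R) (k : nat) :
    measurable_fun setT (fun p : psigma k * Xi => g k p.1 p.2) ->
    measurable_fun setT (fun t : T => g k t (xis k.+1 t)).
  move=> mg; apply: (measurableT_comp (g := fun t : T => (t : psigma k, xis k.+1 t)) mg).
  apply: measurable_fun_pair => //.
  exact: psigma_id_measurable.
have mS : measurable_fun setT S.
  apply: measurable_funM => //; apply: measurable_sum => k.
  exact: mterm (@ms k).
have mV : measurable_fun setT V.
  apply: measurable_sum => k; apply: measurable_funM => //; apply: measurable_funB.
    exact: measurableT_comp (mmean (k := k)) (psigma_id_measurable mxis (k := k)).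
  exact: mterm (@mb k).
pose tau := (1 + r)^-1.
have r0 : 0 < 1 + r by lra.
have tau01 : 0 <= tau <= 1 by rewrite invr_ge0 ltW//= invf_le1//; lra.
have /andP[tau0 tau1] := tau01.
(* The factors exp(-1) and exp(-3) normalise the two moments, so that Z has expectation at most tau
   + (1 - tau) = 1. *)
pose Z t := tau * expR (- 1) * expR (S t) + (1 - tau) * expR (- 3) * expR (V t).
have mZ1 : measurable_fun setT (fun t => tau * expR (- 1) * expR (S t)).
  by apply: measurable_funM => //; exact: measurable_expR_comp.
have mZ2 : measurable_fun setT (fun t => (1 - tau) * expR (- 3) * expR (V t)).
  by apply: measurable_funM => //; exact: measurable_expR_comp.
have EZ : (\int[P]_t (Z t)%:E <= 1)%E.
  under eq_integral do rewrite EFinD.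
  rewrite ge0_integralD//; last 4 first.
  - by move=> t _; rewrite lee_fin !mulr_ge0 ?expR_ge0.
  - exact/measurable_EFinP.
  - by move=> t _; rewrite lee_fin !mulr_ge0 ?expR_ge0// subr_ge0.
  - exact/measurable_EFinP.
  have scale c (Y : T -> R) (e : R) : 0 <= c -> measurable_fun setT Y ->
      (\int[P]_t (expR (Y t))%:E <= (expR e)%:E)%E ->
      (\int[P]_t (c * expR (- e) * expR (Y t))%:E <= c%:E)%E.
    move=> c0 mY EY; under eq_integral do rewrite EFinM.
    have ce0 : 0 <= c * expR (- e) by rewrite mulr_ge0 ?expR_ge0.
    rewrite (ge0_integralZl_EFin _ measurableT)//; last first.
      by apply/measurable_EFinP; exact: measurable_expR_comp.
    apply: (@le_trans _ _ ((c * expR (- e))%:E * (expR e)%:E)%E).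
      by rewrite lee_wpmul2l// lee_fin.
    by rewrite -EFinM -mulrA -expRD addNr expR0 mulr1.
  have e1 : 0 <= 1 - tau by rewrite subr_ge0.
  apply: le_trans (leeD (scale _ _ _ tau0 mS ES) (scale _ _ _ e1 mV EV)) _.
  by rewrite -EFinD addrC subrK.
have AZ t : A t -> expR Om / 2 <= Z t.
  move=> /AE At.
  have h2 : expR (1 / 2) <= 2 :> R.
    by have := @expR_le1Dxcube R (1 / 2); rewrite (_ : 0 <= _ <= _); [move=> /(_ isT)|]; lra.
  have -> : Z t = tau * expR (S t - 1) + (1 - tau) * expR (V t - 3).
    by rewrite /Z !expRD; ring.
  apply: le_trans (expR_convex _ _ tau01).
  apply: (@le_trans _ _ (expR (Om - 1 / 2))).
    by rewrite expRB ler_pM2l ?expR_gt0// lef_pV2 ?posrE ?expR_gt0.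
  rewrite ler_expR.
  have -> : tau * (S t - 1) + (1 - tau) * (V t - 3) = (S t + r * V t - 1 - 3 * r) / (1 + r).
    by rewrite /tau; field; rewrite gt_eqF.
  (* Once denominators are cleared it suffices that r Om >= 3/2 + 5r/2, which holds for Om > 4 and r
     >= 1. *)
  by rewrite ler_pdivlMr//; nra.
have : ((expR Om / 2)%:E * P A <= 1)%E.
  apply: le_trans EZ; rewrite -[X in P X]setIT -integral_indic//.
  rewrite -(ge0_integralZl_EFin _ measurableT); last 3 first.
  - by move=> t _; rewrite lee_fin.
  - exact/measurable_EFinP.
  - by rewrite divr_ge0// expR_ge0.
  apply: ge0_le_integral => [//|t _|||t _].
  - by rewrite -EFinM lee_fin mulr_ge0// divr_ge0 ?expR_ge0.
  - by apply/measurable_EFinP; apply: measurable_funM.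
  - by apply/measurable_EFinP; apply: measurable_funD.
  rewrite -EFinM lee_fin indicE.
  have [/set_mem tA|_] := boolP (t \in A); first by rewrite mulr1 AZ.
  by rewrite mulr0 addr_ge0// !mulr_ge0 ?expR_ge0// subr_ge0.
rewrite muleC -lee_pdivlMr ?divr_gt0 ?expR_gt0// mul1e invf_div.
by rewrite expRN.
Qed.

End concentration.

(** * Jensen's inequality for uniform averages *)

Lemma convex_on_mean (R : realType) n (D : set 'rV[R]_n) (h : 'rV[R]_n -> R)
    (x : nat -> 'rV[R]_n) N :
  (forall u v l, D u -> D v -> 0 < l < 1 -> D (l *: u + (1 - l) *: v)) ->
  convex_on D h -> (forall k, D (x k)) ->
  D (N.+1%:R^-1 *: \sum_(k < N.+1) x k) /\
  h (N.+1%:R^-1 *: \sum_(k < N.+1) x k) <= N.+1%:R^-1 * \sum_(k < N.+1) h (x k).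
Proof.
move=> cD ch Dx; elim: N => [|N [DN hN]].
  by rewrite !big_ord_recl !big_ord0 !addr0 invr1 scale1r mul1r.
rewrite big_ord_recr [in X in _ /\ _ <= X]big_ord_recr/=.
set u := \sum_(k < N.+1) x k in DN hN *; set a := \sum_(k < N.+1) h (x k) in hN *.
have N0 : 0 < N.+1%:R :> R by rewrite ltr0n.
have NN : N.+2%:R = N.+1%:R + 1 :> R by rewrite -natr1.
(* The weight that the old mean of N.+1 points carries in the mean of N.+2 points. *)
pose l : R := N.+1%:R / N.+2%:R.
have l01 : 0 < l < 1.
  by rewrite /l NN divr_gt0 ?addr_gt0//= ltr_pdivrMr ?addr_gt0// mul1r ltrDl.
have l1 : 1 - l = N.+2%:R^-1 by rewrite /l NN; field; rewrite gt_eqF// addr_gt0.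
have lN : l * N.+1%:R^-1 = N.+2%:R^-1 by rewrite /l mulrAC divff ?gt_eqF// mul1r.
have -> : N.+2%:R^-1 *: (u + x N.+1) = l *: (N.+1%:R^-1 *: u) + (1 - l) *: x N.+1.
  by rewrite scalerA lN l1 scalerDr.
split; first exact: cD.
apply: le_trans (ch _ _ _ DN (Dx _) l01) _.
have /andP[l0 _] := l01.
by have := ler_wpM2l (ltW l0) hN; rewrite mulrA lN l1 mulrDr lerD2r.
Qed.

(** * Measurability of function values and proximal maps *)

Section measurability.
Context {d} {T : measurableType d} {R : realType} {n : nat}.
Implicit Types U V : T -> 'rV[R]_n.

Lemma measurable_dotv U V : coord_measurable U -> coord_measurable V ->
  measurable_fun setT (fun t => dotv (U t) (V t)).
Proof. by move=> mU mV; apply: measurable_sum => i; exact: measurable_funM. Qed.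

Lemma coord_measurableD U V : coord_measurable U -> coord_measurable V ->
  coord_measurable (fun t => U t + V t).
Proof.
move=> mU mV i; under eq_fun do rewrite mxE.
by apply: measurable_funD; [exact: mU|exact: mV].
Qed.

Lemma coord_measurableZ a U : coord_measurable U -> coord_measurable (fun t => a *: U t).
Proof.
move=> mU i; under eq_fun do rewrite mxE.
by apply: measurable_funM => //; exact: mU.
Qed.

Lemma coord_measurable_cst u : coord_measurable (fun _ : T => u : 'rV[R]_n).
Proof. by move=> i; exact: measurable_cst. Qed.

Lemma coord_measurableB U V : coord_measurable U -> coord_measurable V ->
  coord_measurable (fun t => U t - V t).
Proof.
move=> mU mV i; under eq_fun do rewrite !mxE.
by apply: measurable_funB; [exact: mU|exact: mV].
Qed.

Lemma coord_measurable_sum I (r : seq I) (U : I -> T -> 'rV[R]_n) :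
  (forall k, coord_measurable (U k)) ->
  coord_measurable (fun t => \sum_(k <- r) U k t).
Proof.
move=> mU i; under eq_fun do rewrite summxE.
by apply: measurable_sum => k; exact: mU.
Qed.

Lemma coord_measurable_comp d' (T' : measurableType d') (g : T' -> T) U :
  coord_measurable U -> measurable_fun setT g -> coord_measurable (fun t => U (g t)).
Proof. by move=> mU mg i; exact: measurableT_comp (mU i) mg. Qed.

Lemma fine_lsc_measurable (h : 'rV[R]_n -> \bar R) U : proper_fun h ->
  lower_semicontinuous h -> coord_measurable U -> (forall t, edom h (U t)) ->
  measurable_fun setT (fun t => fine (h (U t))).
Proof.
move=> ph /lower_semicontinuousP lsc mU dU.
suff : measurable_fun setT (fun t => - fine (h (U t))).
  by move=> mN; under eq_fun do rewrite -[fine _]opprK; exact: measurable_funN.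
apply: (measurable_usc_along mU) => t c; rewrite ltrNl => cU.
exists [set x | ((- c)%:E < h x)%E]; split; first exact: lsc.
  by rewrite /= -(edom_fineK ph (dU t)) lte_fin.
by move=> t' /=; rewrite -(edom_fineK ph (dU t')) lte_fin ltrNl.
Qed.

(** Continuity relative to [D] suffices, since the neighbourhoods are tested only on values of [U],
    all of which lie in [D]. *)
Lemma within_continuous_measurable (D : set 'rV[R]_n) (f : 'rV[R]_n -> R) U :
  {within D, continuous f} -> coord_measurable U -> (forall t, D (U t)) ->
  measurable_fun setT (fun t => f (U t)).
Proof.
move=> /subspace_continuousP cf mU DU.
apply: (measurable_usc_along mU) => t c fc.
have := cf _ (DU t) _ (open_nbhs_nbhs (conj (@open_lt R c) fc)).
rewrite /= => nt; exists ((fun u => D u -> f u < c)^°); split.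
- exact: open_interior.
- exact: nt.
- by move=> t' /interior_subset; apply.
Qed.

(** The proximal point is a nonexpansive function of its centre: adding the two strong inequalities
    at t and t' gives |V - V'|^2 <= <V - V', U - U'>. Each coordinate of [V] is thus continuous
    along [U]. *)
Lemma is_prox_measurable (h : 'rV[R]_n -> \bar R) gamma U V :
  proper_fun h -> 0 < gamma -> econvex h -> coord_measurable U ->
  (forall t, is_prox h gamma (U t) (V t)) -> coord_measurable V.
Proof.
move=> ph g0 cvx mU prox i.
have lip t t' : (V t ord0 i - V t' ord0 i) ^+ 2 <= dotv (U t - U t') (U t - U t').
  apply: (@le_trans _ _ (dotv (V t - V t') (V t - V t'))).
    rewrite /dotv (bigD1 i)//= !mxE -expr2 lerDl.
    by apply: sumr_ge0 => j _; rewrite -expr2 sqr_ge0.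
  have /= := is_prox_strong ph g0 cvx (prox t) (is_prox_edom ph (prox t')).
  have /= := is_prox_strong ph g0 cvx (prox t') (is_prox_edom ph (prox t)).
  have := dotv_ge0 (V t - V t' - (U t - U t')).
  rewrite !dotvE.
  rewrite (dotvC (V t') (V t)) (dotvC (U t) (V t)) (dotvC (U t') (V t))
   (dotvC (U t) (V t')) (dotvC (U t') (V t')) (dotvC (U t') (U t)).
  have g2 : 0 < (2 * gamma)^-1 by rewrite invr_gt0 mulr_gt0.
  move=> h0 h1 h2.
  have h3 := lerD h1 h2.
  set vv := dotv (V t) (V t) in h0 h3 *; set vv' := dotv (V t) (V t') in h0 h3 *.
  set v'v' := dotv (V t') (V t') in h0 h3 *.
  set vu := dotv (V t) (U t) in h0 h3 *; set vu' := dotv (V t) (U t') in h0 h3 *.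
  set v'u := dotv (V t') (U t) in h0 h3 *; set v'u' := dotv (V t') (U t') in h0 h3 *.
  have : (2 * gamma)^-1 * (2 * (vv - 2 * vv' + v'v') - 2 * (vu - vu' - v'u + v'u')) <= 0.
    by move: h3; set G := (2 * gamma)^-1; lra.
  by rewrite pmulr_rle0//; lra.
apply: (measurable_usc_along mU) => t c Vc.
exists [set u | dotv (U t - u) (U t - u) < (c - V t ord0 i) ^+ 2].
have c0 : 0 < c - V t ord0 i by rewrite subr_gt0.
split => [||t' /= Ut'].
- exact: open_dotv_lt.
- by rewrite /= subrr /dotv big1 ?exprn_gt0// => j _; rewrite mxE mul0r.
- have := le_lt_trans (lip t t') Ut'; rewrite ltNge => /negP ltc.
  by rewrite ltNge; apply/negP => cV; apply: ltc; nra.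
Qed.

End measurability.

(** * One oracle call *)

Lemma discriminant_le (R : realFieldType) (A B C : R) : 0 <= C ->
  (forall l, 0 <= A - 2 * l * B + l ^+ 2 * C) -> B ^+ 2 <= A * C.
Proof.
rewrite le_eqVlt => /predU1P[<- q|C0 q].
  have [->|B0] := eqVneq B 0; first by rewrite mulr0 expr0n.
  (* With C = 0 the form is affine in l, and this l makes it equal to -1. *)
  have := q ((A + 1) / (2 * B)); have -> : 2 * ((A + 1) / (2 * B)) * B = A + 1 by field.
  lra.
have := q (B / C).
have -> : A - 2 * (B / C) * B + (B / C) ^+ 2 * C = (A * C - B ^+ 2) / C.
  by field; rewrite gt_eqF.
by rewrite pmulr_lge0 ?invr_gt0// subr_ge0.
Qed.

Section product_space.
Context {R : realType} {n m : nat}.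
Implicit Types (u w : 'rV[R]_n) (v z : 'rV[R]_m).

Lemma znorm_sqr (p : 'rV[R]_n * 'rV[R]_m) :
  znorm p ^+ 2 = dotv p.1 p.1 + dotv p.2 p.2.
Proof. by rewrite sqr_sqrtr// addr_ge0// dotv_ge0. Qed.

Lemma znorm_cauchy u w v z :
  (dotv u w + dotv v z) ^+ 2 <= znorm (u, v) ^+ 2 * znorm (w, z) ^+ 2.
Proof.
rewrite !znorm_sqr/=; apply: discriminant_le => [|l]; first by rewrite addr_ge0// dotv_ge0.
have := addr_ge0 (dotv_ge0 (u - l *: w)) (dotv_ge0 (v - l *: z)).
by rewrite !dotvE (dotvC w u) (dotvC z v); lra.
Qed.

Lemma dotv_le_znorm u w v z (a c : R) : znorm (u, v) <= a -> znorm (w, z) <= c ->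
  `|dotv u w + dotv v z| <= a * c.
Proof.
move=> ua wc.
have u0 : 0 <= znorm (u, v) by exact: sqrtr_ge0.
have w0 : 0 <= znorm (w, z) by exact: sqrtr_ge0.
apply: (@le_trans _ _ (znorm (u, v) * znorm (w, z))); last exact: ler_pM.
rewrite -[leRHS]ger0_norm ?mulr_ge0// -ler_sqr ?nnegrE// !real_normK ?num_real//.
by rewrite exprMn; exact: znorm_cauchy.
Qed.

End product_space.

Section oracle.
Context {R : realType} {n m : nat}.
Context {dT : measure_display} {T : measurableType dT} (P : probability T R).
Context {dX : measure_display} {Xi : measurableType dX} (xi : T -> Xi).
Variables (vt : 'rV[R]_n -> \bar R) (om : 'rV[R]_m -> \bar R).
Variable f : 'rV[R]_n -> 'rV[R]_m -> R.
Variables (xs x : 'rV[R]_n) (ys y : 'rV[R]_m).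
Variables (Gx : Xi -> 'rV[R]_n) (Gy : Xi -> 'rV[R]_m).
Variables (gx : 'rV[R]_n) (gy : 'rV[R]_m) (vx : 'rV[R]_n) (vy : 'rV[R]_m).
Variables (M kappa rho gamma : R).
Hypotheses (vt_proper : proper_fun vt) (om_proper : proper_fun om).
Hypotheses (dx : edom vt x) (dy : edom om y) (dxs : edom vt xs) (dys : edom om ys).
Hypotheses (mGx : coord_measurable (Gx \o xi)) (mGy : coord_measurable (Gy \o xi)).
Hypothesis G_bound : forall s, znorm (Gx s, - Gy s) <= kappa.
Hypothesis Egx : forall i, ('E_P[fun t => Gx (xi t) ord0 i] = (gx ord0 i)%:E)%E.
Hypothesis Egy : forall i, ('E_P[fun t => Gy (xi t) ord0 i] = (gy ord0 i)%:E)%E.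
Hypothesis gx_sub : subdiff_on (edom vt) (fun x' => f x' y) x gx.
Hypothesis gy_sub : subdiff_on (edom om) (fun y' => - f x y') y (- gy).
Hypotheses (vx_sub : esubdiff vt x vx) (vy_sub : esubdiff om y vy).
Hypotheses (M0 : 0 < M) (rho0 : 0 < rho) (gamma0 : 0 < gamma).
Hypothesis light_tail :
  ('E_P[fun t => expR (znorm (vx + Gx (xi t), vy - Gy (xi t)) ^+ 2 / M ^+ 2)%R]
     <= (expR 1)%:E)%E.
Hypothesis near_saddle : znorm (x - xs, y - ys) <= rho.

(** Not centred: its mean is subtracted later. The minus sign comes from G = (Gx, -Gy), and the
    divisor rho M is the Cauchy-Schwarz scale. *)
Definition inner_noise (s : Xi) : R :=
  (dotv (Gx s) (x - xs) - dotv (Gy s) (y - ys)) / (rho * M).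

(* A jointly measurable lower bound of [||v + G||^2 / M^2]: the subgradient
   selection [v] of (B1) need not be measurable in [z]. *)
Definition scaled_gap (s : Xi) : R :=
  2 / (gamma * M ^+ 2) * (moreau_gap vt gamma x (Gx s) + moreau_gap om gamma y (- Gy s)).

(** The real-valued form of [eps_phi], grouped as a convex function of [x] plus a convex function of
    [y]. *)
Definition primal_dual_gap : R :=
  fine (vt x) + f x ys - fine (vt xs) + (fine (om y) - f xs y - fine (om ys)).

Let rM0 : 0 < rho * M. Proof. exact: mulr_gt0. Qed.

Lemma inner_noise_bound s : `|inner_noise s| <= kappa / M.
Proof.
rewrite /inner_noise normrM normfV [X in _ / X]gtr0_norm// ler_pdivrMr//.
rewrite mulrCA divfK ?gt_eqF// mulrC -dotvNl.
exact: dotv_le_znorm.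
Qed.

Lemma measurable_inner_noise : measurable_fun setT (inner_noise \o xi).
Proof.
apply: measurable_funM => //; apply: measurable_funB.
  by apply: measurable_dotv => //; exact: coord_measurable_cst.
by apply: measurable_dotv => //; exact: coord_measurable_cst.
Qed.

Let integrable_coord k (G : T -> 'rV[R]_k) (w : 'rV[R]_k) i :
  coord_measurable G -> (forall t, dotv (G t) (G t) <= kappa ^+ 2) ->
  P.-integrable setT (fun t => (G t ord0 i * w ord0 i)%:E).
Proof.
move=> mG GB.
apply: (@le_integrable _ _ _ _ _ measurableT _ (EFin \o cst (`|kappa| * `|w ord0 i|))).
- by apply/measurable_EFinP/measurable_funM => //; exact: mG.
- move=> t _ /=; rewrite lee_fin (le_trans _ (ler_norm _))// normrM ler_wpM2r//.
  rewrite -ler_sqr ?nnegrE// !real_normK ?num_real//; apply: le_trans (GB t).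
  rewrite /dotv (bigD1 i)//= -expr2 lerDl.
  by apply: sumr_ge0 => j _; rewrite -expr2 sqr_ge0.
- exact: finite_measure_integrable_cst.
Qed.

Let integral_dotv k (G : T -> 'rV[R]_k) (g w : 'rV[R]_k) :
  coord_measurable G -> (forall t, dotv (G t) (G t) <= kappa ^+ 2) ->
  (forall i, ('E_P[fun t => G t ord0 i] = (g ord0 i)%:E)%E) ->
  P.-integrable setT (EFin \o (fun t => dotv (G t) w)) /\
  (\int[P]_t (dotv (G t) w)%:E = (dotv g w)%:E)%E.
Proof.
move=> mG GB Eg.
have ic := integrable_coord w _ mG GB.
split.
  have -> : EFin \o (fun t => dotv (G t) w) =
      (fun t => \sum_(i <- index_enum 'I_k) (G t ord0 i * w ord0 i)%:E)%E.
    by apply/funext => t; rewrite /= sumEFin.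
  exact: integrable_sum.
under eq_integral do rewrite /dotv -sumEFin.
rewrite integral_sum// /dotv -sumEFin; apply: eq_bigr => i _.
under eq_integral do rewrite mulrC EFinM.
have i1 : P.-integrable setT (fun t => (G t ord0 i)%:E).
  have := integrable_coord (const_mx 1) i mG GB.
  by under eq_fun do rewrite mxE mulr1.
rewrite integralZl//.
by have := Eg i; rewrite unlock => ->; rewrite -EFinM mulrC.
Qed.

Let G_sqr s : dotv (Gx s) (Gx s) + dotv (Gy s) (Gy s) <= kappa ^+ 2.
Proof.
have k0 : 0 <= kappa by rewrite (le_trans _ (G_bound s))// sqrtr_ge0.
have <- : znorm (Gx s, - Gy s) ^+ 2 = dotv (Gx s) (Gx s) + dotv (Gy s) (Gy s).
  by rewrite znorm_sqr/= dotvNl dotvNr opprK.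
by rewrite ler_sqr ?nnegrE ?sqrtr_ge0.
Qed.

Let noise_mean : P.-integrable setT (EFin \o (inner_noise \o xi)) /\
  (\int[P]_t (inner_noise (xi t))%:E =
     ((dotv gx (x - xs) - dotv gy (y - ys)) / (rho * M))%:E)%E.
Proof.
have bx t : dotv ((Gx \o xi) t) ((Gx \o xi) t) <= kappa ^+ 2.
  by apply: le_trans (G_sqr (xi t)); rewrite lerDl dotv_ge0.
have byy t : dotv ((Gy \o xi) t) ((Gy \o xi) t) <= kappa ^+ 2.
  by apply: le_trans (G_sqr (xi t)); rewrite lerDr dotv_ge0.
have [i1 e1] := integral_dotv (x - xs) mGx bx Egx.
have [i2 e2] := integral_dotv (y - ys) mGy byy Egy.
have i12 := integrableB measurableT i1 i2.
have noiseE : EFin \o (inner_noise \o xi) = (fun t => (rho * M)^-1%:E *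
    ((dotv (Gx (xi t)) (x - xs))%:E - (dotv (Gy (xi t)) (y - ys))%:E))%E.
  by apply/funext => t; rewrite /inner_noise/= -EFinB -EFinM mulrC.
split; first by rewrite noiseE; exact: integrableZl.
rewrite -[fun t => (inner_noise (xi t))%:E]/(EFin \o (inner_noise \o xi)) noiseE.
by rewrite integralZl// integralB// e1 e2 -EFinB -EFinM mulrC.
Qed.

Let tail s := znorm (vx + Gx s, vy - Gy s) ^+ 2 / M ^+ 2.

(** Added to [inner_noise], it gives <v + G, z - zs> / (rho M), whose square Cauchy-Schwarz bounds
    by [tail]. *)
Let shift : R := (dotv vx (x - xs) + dotv vy (y - ys)) / (rho * M).

Let noise_shift_sqr s : (inner_noise s + shift) ^+ 2 <= tail s.
Proof.
have -> : inner_noise s + shift =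
    (dotv (vx + Gx s) (x - xs) + dotv (vy - Gy s) (y - ys)) / (rho * M).
  by rewrite /inner_noise /shift (dotvDl vx) (dotvDl vy) dotvNl; ring.
rewrite exprMn exprVn ler_pdivrMr ?exprn_gt0//.
apply: le_trans (znorm_cauchy _ _ _ _) _.
have -> : tail s * (rho * M) ^+ 2 = znorm (vx + Gx s, vy - Gy s) ^+ 2 * rho ^+ 2.
  by rewrite /tail; field; rewrite gt_eqF.
by rewrite ler_wpM2l ?sqr_ge0// ler_sqr ?nnegrE ?sqrtr_ge0// ltW.
Qed.

Let mtail : measurable_fun setT (tail \o xi).
Proof.
rewrite (_ : tail \o xi = fun t => (dotv (vx + Gx (xi t)) (vx + Gx (xi t)) +
  dotv (vy - Gy (xi t)) (vy - Gy (xi t))) / M ^+ 2); last first.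
  by apply/funext => t; rewrite /tail/= znorm_sqr.
have m1 : coord_measurable (fun t => vx + Gx (xi t)).
  by apply: coord_measurableD => //; exact: coord_measurable_cst.
have m2 : coord_measurable (fun t => vy - Gy (xi t)).
  by apply: coord_measurableB => //; exact: coord_measurable_cst.
by apply: measurable_funM => //; apply: measurable_funD; exact: measurable_dotv.
Qed.

Let exp_le_tail (Y : T -> R) : measurable_fun setT Y -> (forall t, Y t <= tail (xi t)) ->
  (\int[P]_t (expR (Y t))%:E <= (expR 1)%:E)%E.
Proof.
move=> mY Yt; move: light_tail; rewrite unlock; apply: le_trans.
have mexp (Z : T -> R) : measurable_fun setT Z -> measurable_fun setT (fun t => (expR (Z t))%:E).
  move=> mZ; apply/measurable_EFinP; apply: (measurableT_comp _ mZ).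
  exact: measurable_expR.
apply: ge0_le_integral => [//|t _|||t _].
- by rewrite lee_fin expR_ge0.
- exact: mexp.
- exact: mexp mtail.
- by rewrite lee_fin ler_expR.
Qed.

Lemma inner_noise_exp : exists c,
  (\int[P]_t (expR ((inner_noise (xi t) + c) ^+ 2))%:E <= (expR 1)%:E)%E.
Proof.
exists shift; apply: exp_le_tail => [|t]; last exact: noise_shift_sqr.
by apply: measurable_funX; apply: measurable_funD => //; exact: measurable_inner_noise.
Qed.

Lemma scaled_gap_le s : scaled_gap s <= tail s.
Proof.
rewrite /scaled_gap /tail znorm_sqr/=.
have := moreau_gap_le vt_proper gamma0 (Gx s) dx vx_sub.
have := moreau_gap_le om_proper gamma0 (- Gy s) dy vy_sub.
move=> h1 h2; have h := lerD h2 h1.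
have g0 : 0 < 2 / (gamma * M ^+ 2) by rewrite divr_gt0// mulr_gt0// exprn_gt0.
apply: (le_trans (ler_wpM2l (ltW g0) h)); rewrite le_eqVlt; apply/orP; left; apply/eqP.
by field; rewrite !gt_eqF.
Qed.

Lemma scaled_gap_exp : measurable_fun setT (scaled_gap \o xi) ->
  (\int[P]_t (expR (scaled_gap (xi t)))%:E <= (expR 1)%:E)%E.
Proof. by move=> mg; apply: exp_le_tail => // t; exact: scaled_gap_le. Qed.

(** Add the subgradient inequalities in [x] (tested at [xs]) and in [y] (tested at [ys]); the common
    value [f x y] cancels. *)
Lemma primal_dual_gap_le_mean : primal_dual_gap <=
  fine (vt x) - fine (vt xs) + (fine (om y) - fine (om ys)) +
  rho * M * \int[P]_t inner_noise (xi t).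
Proof.
have [_ e] := noise_mean; rewrite /Rintegral e/= mulrC divfK ?gt_eqF//.
have := gx_sub dxs; have := gy_sub dys.
rewrite -(opprB x xs) -(opprB y ys) !dotvNr dotvNl /primal_dual_gap; lra.
Qed.

(** The subgradients of [vt] and [om] reduce the gap to rho M times the mean of the shifted noise,
    whose second moment is at most 1. *)
Lemma primal_dual_gap_le : primal_dual_gap <= rho * M.
Proof.
apply: (le_trans primal_dual_gap_le_mean).
have vtle := esubdiff_le vt_proper vx_sub dx dxs.
have omle := esubdiff_le om_proper vy_sub dy dys.
suff : \int[P]_t inner_noise (xi t) + shift <= 1.
  rewrite /shift -(ler_pM2l rM0) mulrDr mulr1 [_ * (_ / _)]mulrC divfK ?gt_eqF//.
  move: vtle omle; rewrite -(opprB x xs) -(opprB y ys) !dotvNr; lra.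
have [i e] := noise_mean.
have mY : measurable_fun setT (fun t => inner_noise (xi t) + shift).
  by apply: measurable_funD => //; exact: measurable_inner_noise.
have ic : P.-integrable setT (EFin \o cst shift) by exact: finite_measure_integrable_cst.
have iY := integrableD measurableT i ic.
have EY : (\int[P]_t (inner_noise (xi t) + shift)%:E =
    (\int[P]_t inner_noise (xi t) + shift)%:E)%E.
  under eq_integral do rewrite EFinD.
  rewrite (integralD _ i ic)//= integral_cst//= probability_setT mule1 EFinD.
  by rewrite /Rintegral fineK//; exact: (integrable_fin_num measurableT i).
have mY2 : measurable_fun setT (fun t => (inner_noise (xi t) + shift) ^+ 2).
  exact: measurable_funX.
have Y2 : (\int[P]_t ((inner_noise (xi t) + shift) ^+ 2)%:E <= 1)%E.
  by apply: sqr_moment_le1 => //; apply: exp_le_tail => // t; exact: noise_shift_sqr.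
have Y2i : P.-integrable setT (EFin \o (fun t => (inner_noise (xi t) + shift) ^+ 2)).
  apply/integrableP; split; first exact/measurable_EFinP.
  under eq_integral do rewrite /= ger0_norm ?sqr_ge0//.
  by rewrite (le_lt_trans Y2)// ltry.
rewrite -lee_fin -EY.
(* Integrate Y <= (1 + Y^2) / 2 for the shifted noise Y. *)
apply: (@le_trans _ _ (\int[P]_t ((1 / 2)%:E + (1 / 2)%:E * ((inner_noise (xi t) + shift) ^+ 2)%:E))%E).
  apply: le_integral => //.
    by apply: integrableD => //; [exact: finite_measure_integrable_cst|exact: integrableZl].
  move=> t _; rewrite -EFinM -EFinD lee_fin.
  by have := sqr_ge0 (inner_noise (xi t) + shift - 1); lra.
rewrite integralD//=; last 2 first.
- exact: finite_measure_integrable_cst.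
- exact: integrableZl.
rewrite integral_cst//= probability_setT mule1 integralZl//.
apply: (@le_trans _ _ ((1 / 2)%:E + (1 / 2)%:E * 1)%E).
  by rewrite leeD2l// lee_wpmul2l// lee_fin.
by rewrite -EFinM -EFinD lee_fin; lra.
Qed.

End oracle.

(** * Measurability along the iterates, averaged gap and rescaled threshold *)

Lemma oracle_measurable_comp d (T : measurableType d) dX (Xi : measurableType dX)
    (R : realType) n m p (G : 'rV[R]_n -> 'rV[R]_m -> Xi -> 'rV[R]_p)
    (U : T -> 'rV[R]_n) (V : T -> 'rV[R]_m) (W : T -> Xi) :
  oracle_measurable G -> coord_measurable U -> coord_measurable V ->
  measurable_fun setT W -> coord_measurable (fun t => G (U t) (V t) (W t)).
Proof.
move=> mG mU mV mW i.
apply: (measurableT_comp (g := fun t => (((U t : Vec R n), (V t : Vec R m)), W t)) (mG i)).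
apply: measurable_fun_pair => //.
by apply: measurable_fun_pair; exact: coord_measurable_Vec.
Qed.

(** One fixed pair [x0], [v0] makes the envelope finite everywhere, so no measurable choice of
    subgradients along [U] enters. *)
Lemma moreau_gap_measurable d (T : measurableType d) (R : realType) n
    (h : 'rV[R]_n -> \bar R) gamma x0 v0 (U G : T -> 'rV[R]_n) :
  proper_fun h -> lower_semicontinuous h -> 0 < gamma ->
  edom h x0 -> esubdiff h x0 v0 ->
  coord_measurable U -> coord_measurable G -> (forall t, edom h (U t)) ->
  measurable_fun setT (fun t => moreau_gap h gamma (U t) (G t)).
Proof.
move=> ph lsc g0 dx0 hv0 mU mG dU; apply: measurable_funB; last first.
  apply: (moreau_env_measurable ph g0 dx0 hv0).
  by apply: coord_measurableB => //; exact: coord_measurableZ.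
apply: measurable_funD; first exact: fine_lsc_measurable.
by apply: measurable_funM => //; exact: measurable_dotv.
Qed.

Lemma primal_dual_gap_mean (R : realType) n m (vt : 'rV[R]_n -> \bar R)
    (om : 'rV[R]_m -> \bar R) (f : 'rV[R]_n -> 'rV[R]_m -> R) xs ys
    (x : nat -> 'rV[R]_n) (y : nat -> 'rV[R]_m) N :
  proper_fun vt -> econvex vt -> proper_fun om -> econvex om ->
  (forall y, edom om y -> convex_on (edom vt) (fun x => f x y)) ->
  (forall x, edom vt x -> convex_on (edom om) (fun y => - f x y)) ->
  edom vt xs -> edom om ys -> (forall k, Zdom vt om (x k, y k)) ->
  Zdom vt om (N.+1%:R^-1 *: \sum_(k < N.+1) x k, N.+1%:R^-1 *: \sum_(k < N.+1) y k) /\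
  primal_dual_gap vt om f xs (N.+1%:R^-1 *: \sum_(k < N.+1) x k)
      ys (N.+1%:R^-1 *: \sum_(k < N.+1) y k) <=
    N.+1%:R^-1 * \sum_(k < N.+1) primal_dual_gap vt om f xs (x k) ys (y k).
Proof.
move=> pv cv po co fx fy dxs dys xy.
have dx k : edom vt (x k) by case: (xy k).
have dy k : edom om (y k) by case: (xy k).
have c1 : convex_on (edom vt) (fun u => fine (vt u) + f u ys).
  move=> u w l du dw l01; have [_ h1] := edom_convex pv cv l01 du dw.
  by have := fx _ dys _ _ _ du dw l01; lra.
have c2 : convex_on (edom om) (fun u => fine (om u) + - f xs u).
  move=> u w l du dw l01; have [_ h1] := edom_convex po co l01 du dw.
  by have := fy _ dxs _ _ _ du dw l01; lra.
have [dX hX] := convex_on_mean N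
  (fun u w l du dw l01 => (edom_convex pv cv l01 du dw).1) c1 dx.
have [dY hY] := convex_on_mean N
  (fun u w l du dw l01 => (edom_convex po co l01 du dw).1) c2 dy.
split => //; rewrite /primal_dual_gap.
have -> : \sum_(k < N.+1) (fine (vt (x k)) + f (x k) ys - fine (vt xs) +
      (fine (om (y k)) - f xs (y k) - fine (om ys))) =
    \sum_(k < N.+1) (fine (vt (x k)) + f (x k) ys) +
    \sum_(k < N.+1) (fine (om (y k)) - f xs (y k)) -
    N.+1%:R * (fine (vt xs) + fine (om ys)).
  have -> : N.+1%:R * (fine (vt xs) + fine (om ys)) =
      \sum_(k < N.+1) (fine (vt xs) + fine (om ys)).
    by rewrite sumr_const card_ord mulr_natl.
  rewrite -big_split/= -sumrB.
  by apply: eq_bigr => k _; ring.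
rewrite mulrBr mulrDr mulrA mulVf ?pnatr_eq0// mul1r.
move: hX hY => /= hX hY; have h := lerD hX hY; rewrite -(lerD2r (fine (vt xs) + fine (om ys))).
rewrite subrK; apply: le_trans h; rewrite le_eqVlt; apply/orP; left; apply/eqP.
ring.
Qed.

Lemma eps_phi_primal_dual_gap (R : realType) n m (vt : 'rV[R]_n -> \bar R)
    (om : 'rV[R]_m -> \bar R) (f : 'rV[R]_n -> 'rV[R]_m -> R) xs ys x y :
  proper_fun vt -> proper_fun om -> Zdom vt om (xs, ys) -> Zdom vt om (x, y) ->
  eps_phi vt om f xs ys (x, y) = (primal_dual_gap vt om f xs x ys y)%:E.
Proof.
move=> pv po [/= dxs dys] [/= dx dy]; rewrite /eps_phi /phi/=.
rewrite -(edom_fineK pv dx) -(edom_fineK pv dxs) -(edom_fineK po dy) -(edom_fineK po dys).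
by rewrite -!(EFinN, EFinD) /primal_dual_gap/=; congr EFin; ring.
Qed.

Lemma within_continuous_fst (R : realType) n m (A : set 'rV[R]_n) (B : set 'rV[R]_m)
    (f : 'rV[R]_n -> 'rV[R]_m -> R) y :
  {within [set z | A z.1 /\ B z.2], continuous (fun z => f z.1 z.2)} -> B y ->
  {within A, continuous (fun x => f x y)}.
Proof.
move=> /subspace_continuousP cf By; apply/subspace_continuousP => x Ax.
move=> Q nQ; have := cf (x, y) (conj Ax By) Q nQ.
rewrite /within/= => -[[U V] /= [nU nV] UV].
suff : \forall u \near x, A u -> Q (f u y) by [].
near=> u => Au.
apply: (UV (u, y)) => //=; split => /=; last exact: nbhs_singleton.
by near: u.
Unshelve. all: by end_near. Qed.

Lemma within_continuous_snd (R : realType) n m (A : set 'rV[R]_n) (B : set 'rV[R]_m)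
    (f : 'rV[R]_n -> 'rV[R]_m -> R) x :
  {within [set z | A z.1 /\ B z.2], continuous (fun z => f z.1 z.2)} -> A x ->
  {within B, continuous (fun y => f x y)}.
Proof.
move=> /subspace_continuousP cf Ax; apply/subspace_continuousP => y By.
move=> Q nQ; have := cf (x, y) (conj Ax By) Q nQ.
rewrite /within/= => -[[U V] /= [nU nV] UV].
suff : \forall u \near y, B u -> Q (f x u) by [].
near=> u => Bu.
apply: (UV (x, u)) => //=; split => /=; first exact: nbhs_singleton.
by near: u.
Unshelve. all: by end_near. Qed.

(** Divide by D M mx / (2 sN). The initial distance becomes theta^-1 / mx <= 1, the factor of S
    becomes theta / mx <= 1, and the surplus 2 q^2 Om on the left is dropped. *)
Lemma threshold_rescale (R : realType) (D M th sN q Om S W : R) :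
  0 < D -> 0 < M -> 0 < th -> 0 < sN -> 0 < q -> 0 < Om -> 0 <= S ->
  let mx := Num.max th th^-1 in let gamma := th * D / (M * sN) in
  D * M * mx / (2 * sN) * (3 + 2 * q * (1 + q)) * Om <=
    (sN ^+ 2)^-1 * (D ^+ 2 / (2 * gamma) + gamma * M ^+ 2 / 2 * (sN ^+ 2 * S)
      + (1 + q) * D * M * W) ->
  (1 + 2 * (1 + q)) * Om - 1 <= S + (1 + q) * (2 / (sN * mx) * W).
Proof.
move=> D0 M0 th0 sN0 q0 Om0 S0 mx gamma.
have mx1 : th <= mx by rewrite le_max lexx.
have mx2 : th^-1 <= mx by rewrite le_max lexx orbT.
have mx0 : 0 < mx by rewrite (lt_le_trans th0).
pose K := D * M / (2 * sN).
have K0 : 0 < K by rewrite divr_gt0 ?mulr_gt0.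
have -> : D * M * mx / (2 * sN) * (3 + 2 * q * (1 + q)) * Om =
    K * mx * ((3 + 2 * q * (1 + q)) * Om).
  by rewrite /K; field; rewrite gt_eqF.
have -> : (sN ^+ 2)^-1 * (D ^+ 2 / (2 * gamma) + gamma * M ^+ 2 / 2 * (sN ^+ 2 * S)
      + (1 + q) * D * M * W) =
    K * mx * (th^-1 / mx + th / mx * S + (1 + q) * (2 / (sN * mx) * W)).
  by rewrite /K /gamma; field; rewrite !gt_eqF.
rewrite (ler_pM2l (mulr_gt0 K0 mx0)).
have t1 : th^-1 / mx <= 1 by rewrite ler_pdivrMr// mul1r.
have t2 : th / mx * S <= S.
  by rewrite ler_piMl// ler_pdivrMr// mul1r.
have := mulr_gt0 (mulr_gt0 q0 q0) Om0.
lra.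
Qed.

Unset Implicit Arguments.
Set Strict Implicit.

Theorem theorem2p2
  (R : realType) (n m : nat)
  (dT : measure_display) (T : measurableType dT) (P : probability T R)
  (dX : measure_display) (Xi : measurableType dX)
  (vt : 'rV[R]_n -> \bar R) (om : 'rV[R]_m -> \bar R)
  (F : 'rV[R]_n -> 'rV[R]_m -> Xi -> R) (f : 'rV[R]_n -> 'rV[R]_m -> R)
  (xi : T -> Xi) (xis : nat -> T -> Xi)
  (Gx : 'rV[R]_n -> 'rV[R]_m -> Xi -> 'rV[R]_n)
  (Gy : 'rV[R]_n -> 'rV[R]_m -> Xi -> 'rV[R]_m)
  (xs : 'rV[R]_n) (ys : 'rV[R]_m)
  (M kappa0 theta : R) (q : R -> R) (N : nat)
  (x1 : 'rV[R]_n) (y1 : 'rV[R]_m)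
  (X : nat -> T -> 'rV[R]_n) (Y : nat -> T -> 'rV[R]_m)
  (Om : R) :
  (* vartheta, omega : proper, lower semicontinuous, convex *)
  proper_fun vt -> lower_semicontinuous vt -> econvex vt ->
  proper_fun om -> lower_semicontinuous om -> econvex om ->
  (* f = E[F(., ., xi)] finite, continuous, convex-concave on Z *)
  (forall x y, Zdom vt om (x, y) -> ('E_P[fun t => F x y (xi t)] = (f x y)%:E)%E) ->
  {within Zdom vt om, continuous (fun z => f z.1 z.2)} ->
  (forall y, edom om y -> convex_on (edom vt) (fun x => f x y)) ->
  (forall x, edom vt x -> convex_on (edom om) (fun y => - f x y)) ->
  (* (A1) xi_1, xi_2, ... are i.i.d. copies of xi *)
  measurable_fun setT xi ->
  (forall k, measurable_fun setT (xis k)) ->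
  mutually_independent P [set k | (0 < k)%N] xis ->
  (forall k, (0 < k)%N -> same_law P xi (xis k)) ->
  (* (A2) stochastic oracle (jointly measurable), unbiased subgradients *)
  oracle_measurable Gx -> oracle_measurable Gy ->
  (forall x y, Zdom vt om (x, y) ->
     exists (gx : 'rV[R]_n) (gy : 'rV[R]_m),
       (forall i, ('E_P[fun t => Gx x y (xi t) ord0 i] = (gx ord0 i)%:E)%E) /\
       (forall i, ('E_P[fun t => Gy x y (xi t) ord0 i] = (gy ord0 i)%:E)%E) /\
       subdiff_on (edom vt) (fun x' => f x' y) x gx /\
       subdiff_on (edom om) (fun y' => - f x y') y (- gy)) ->
  (* (A3) (xs, ys) in Z is a saddle point of phi on Z *)
  Zdom vt om (xs, ys) ->
  (forall x y, Zdom vt om (x, y) ->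
     (phi vt om f xs y <= phi vt om f xs ys)%E /\
     (phi vt om f xs ys <= phi vt om f x ys)%E) ->
  (* (B1) *)
  0 < M ->
  (forall x y, Zdom vt om (x, y) ->
     exists (vx : 'rV[R]_n) (vy : 'rV[R]_m),
       esubdiff vt x vx /\ esubdiff om y vy /\
       ('E_P[fun t => expR (znorm (vx + Gx x y (xi t), vy - Gy x y (xi t)) ^+ 2
                             / M ^+ 2)%R] <= (expR 1)%:E)%E) ->
  (* (B2) *)
  0 < kappa0 ->
  (forall x y (s : Xi), Zdom vt om (x, y) ->
     znorm (Gx x y s, - Gy x y s) <= kappa0) ->
  (* parameters *)
  (0 < N)%N -> 0 < theta -> 0 < q theta ->
  let gamma := theta * znorm (x1 - xs, y1 - ys) / (M * Num.sqrt N%:R) in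
  0 < gamma ->
  (* SAPS started at z^1 = (x1, y1) in Z with step sizes gamma_k = gamma *)
  Zdom vt om (x1, y1) ->
  (forall t, X 1%N t = x1 /\ Y 1%N t = y1) ->
  (forall t k, (0 < k)%N ->
     is_prox vt gamma (X k t - gamma *: Gx (X k t) (Y k t) (xis k t)) (X k.+1 t) /\
     is_prox om gamma (Y k t + gamma *: Gy (X k t) (Y k t) (xis k t)) (Y k.+1 t)) ->
  (* (B3) *)
  (forall t k, (1 < k)%N ->
     znorm (X k t - xs, Y k t - ys) <= (1 + q theta) * znorm (x1 - xs, y1 - ys)) ->
  4 < Om ->
  let xt := fun t => \sum_(1 <= j < N.+1)
                      (gamma / \sum_(1 <= i < N.+1) gamma) *: X j t in
  let yt := fun t => \sum_(1 <= j < N.+1)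
                      (gamma / \sum_(1 <= i < N.+1) gamma) *: Y j t in
  (P [set t | (eps_phi vt om f xs ys (xt t, yt t) >=
       (znorm (x1 - xs, y1 - ys) * M * Num.max theta theta^-1
          / (2 * Num.sqrt N%:R)
          * (3 + 2 * q theta * (1 + q theta)) * Om)%:E)%E]
   <= (2 * expR (- Om))%:E)%E.
Proof.
move=> vt_proper vt_lsc vt_cvx om_proper om_lsc om_cvx _ f_cont f_cvx f_ccv
  mxi mxis indep law mGx mGy A2 Zs _ M0 B1 kappa0_gt0 B2 N0 theta0 q0 gamma gamma0
  Z1 init saps B3 Om4.
cbv zeta.
have [/= dxs dys] := Zs.
pose D := znorm (x1 - xs, y1 - ys).
have gammaE : gamma = theta * D / (M * Num.sqrt N%:R) by [].
clearbody gamma; rewrite -/D in B3 *.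
pose r := 1 + q theta; rewrite -/r in B3.
have r1 : 1 <= r by rewrite lerDl ltW.
(* A positive step size excludes z^1 = zs. *)
have D0 : 0 < D.
  rewrite lt_def sqrtr_ge0 andbT; apply: contraTneq gamma0 => D0.
  by rewrite gammaE D0 mulr0 mul0r ltxx.
have rho0 : 0 < r * D by rewrite mulr_gt0// (lt_le_trans ltr01).
(* Shifted by one so that index k depends exactly on the samples xi_1, .., xi_k. *)
pose x k t := X k.+1 t; pose y k t := Y k.+1 t.
have Zxy k t : Zdom vt om (x k t, y k t).
  case: k => [|k]; first by rewrite /x /y; have [-> ->] := init t.
  have [px py] := saps t k.+1 isT.
  by split; [exact: is_prox_edom px|exact: is_prox_edom py].
have near k t : znorm (x k t - xs, y k t - ys) <= r * D.
  case: k => [|k]; last exact: B3.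
  by rewrite /x /y; have [-> ->] := init t; rewrite ler_peMl// ltW.
(* This one pair of subgradients at z^1 serves as the fixed reference for all envelope
   measurability. *)
have [vx1 [vy1 [vx1_sub [vy1_sub _]]]] := B1 _ _ Z1.
pose GX k t s := Gx (x k t) (y k t) s.
pose GY k t s := Gy (x k t) (y k t) s.
pose psigma k := g_sigma_algebraType (past xis k).
(* Adaptedness, by induction: the oracle call adds sample k.+1 and the nonexpansive proximal map
   preserves measurability. *)
have mxy k : coord_measurable (x k : psigma k -> _) /\ coord_measurable (y k : psigma k -> _).
  elim: k => [|k [mx my]].
    have -> : x 0%N = fun=> x1 by apply/funext => t; have [] := init t.
    have -> : y 0%N = fun=> y1 by apply/funext => t; have [] := init t.
    by split; exact: coord_measurable_cst.
  have mx' : coord_measurable (x k : psigma k.+1 -> _).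
    exact: (coord_measurable_comp mx (@psigma_succ_measurable _ _ _ _ xis k)).
  have my' : coord_measurable (y k : psigma k.+1 -> _).
    exact: (coord_measurable_comp my (@psigma_succ_measurable _ _ _ _ xis k)).
  have mlast := @past_measurable_last _ _ _ _ xis k.
  split.
    apply: (is_prox_measurable (U := fun t : psigma k.+1 =>
      x k t - gamma *: Gx (x k t) (y k t) (xis k.+1 t)) vt_proper gamma0 vt_cvx) => [|t].
      apply: coord_measurableB => //; apply: coord_measurableZ.
      exact: (oracle_measurable_comp mGx mx' my' mlast).
    by have [] := saps t k.+1 isT.
  apply: (is_prox_measurable (U := fun t : psigma k.+1 =>
    y k t + gamma *: Gy (x k t) (y k t) (xis k.+1 t)) om_proper gamma0 om_cvx) => [|t].
    apply: coord_measurableD => //; apply: coord_measurableZ.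
    exact: (oracle_measurable_comp mGy mx' my' mlast).
  by have [] := saps t k.+1 isT.
have mxyT k : coord_measurable (x k) /\ coord_measurable (y k).
  have [mx my] := mxy k.
  by split; [exact: (coord_measurable_comp mx (psigma_id_measurable mxis (k := k)))|
             exact: (coord_measurable_comp my (psigma_id_measurable mxis (k := k)))].
have mxyX k : coord_measurable (fun p : psigma k * Xi => x k p.1) /\
    coord_measurable (fun p : psigma k * Xi => y k p.1).
  have [mx my] := mxy k.
  by split; [exact: (coord_measurable_comp mx measurable_fst)|
             exact: (coord_measurable_comp my measurable_fst)].
have mGX k : coord_measurable (fun p : psigma k * Xi => GX k p.1 p.2).
  by have [mx my] := mxyX k; exact: (oracle_measurable_comp mGx mx my measurable_snd).
have mGY k : coord_measurable (fun p : psigma k * Xi => GY k p.1 p.2).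
  by have [mx my] := mxyX k; exact: (oracle_measurable_comp mGy mx my measurable_snd).
have mGXt k t : coord_measurable (GX k t \o xi).
  by apply: (oracle_measurable_comp mGx) => //; exact: coord_measurable_cst.
have mGYt k t : coord_measurable (GY k t \o xi).
  by apply: (oracle_measurable_comp mGy) => //; exact: coord_measurable_cst.
have GB k t s : znorm (GX k t s, - GY k t s) <= kappa0 by exact: B2.
pose b k (t : psigma k) s := inner_noise xs (x k t) ys (y k t) (GX k t) (GY k t) M (r * D) s.
pose s k (t : psigma k) := scaled_gap vt om (x k t) (y k t) (GX k t) (GY k t) M gamma.
pose E k t := primal_dual_gap vt om f xs (x k t) ys (y k t).
have E_le k t : E k t <= r * D * M.
  have [dx dy] := Zxy k t.
  have [gx [gy [Egx [Egy [gx_sub gy_sub]]]]] := A2 _ _ (Zxy k t).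
  have [vx [vy [vx_sub [vy_sub tail]]]] := B1 _ _ (Zxy k t).
  exact: (primal_dual_gap_le vt_proper om_proper dx dy dxs dys (mGXt k t) (mGYt k t)
    (GB k t) Egx Egy gx_sub gy_sub vx_sub vy_sub M0 rho0 tail (near k t)).
have E_step k t : E k t <= (znorm (x k t - xs, y k t - ys) ^+ 2 -
      znorm (x k.+1 t - xs, y k.+1 t - ys) ^+ 2) / (2 * gamma) +
    gamma * M ^+ 2 / 2 * s k t (xis k.+1 t) +
    r * D * M * (\int[P]_t' b k t (xi t') - b k t (xis k.+1 t)).
  have [dx dy] := Zxy k t.
  have [gx [gy [Egx [Egy [gx_sub gy_sub]]]]] := A2 _ _ (Zxy k t).
  have [vx [vy [vx_sub [vy_sub _]]]] := B1 _ _ (Zxy k t).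
  have h1 := primal_dual_gap_le_mean dxs dys (mGXt k t) (mGYt k t) (GB k t)
    Egx Egy gx_sub gy_sub M0 rho0.
  have [px py] := saps t k.+1 isT.
  have h2 := prox_step vt_proper gamma0 vt_cvx dx vx_sub px dxs.
  (* The ascent step in y is a descent step with direction - [GY]. *)
  have h3 : is_prox om gamma (y k t - gamma *: - GY k t (xis k.+1 t)) (y k.+1 t).
    by rewrite scalerN opprK.
  have {}h3 := prox_step om_proper gamma0 om_cvx dy vy_sub h3 dys.
  have sE : gamma * M ^+ 2 / 2 * s k t (xis k.+1 t) =
      moreau_gap vt gamma (x k t) (GX k t (xis k.+1 t)) +
      moreau_gap om gamma (y k t) (- GY k t (xis k.+1 t)).
    by rewrite /s /scaled_gap; field; rewrite !gt_eqF.
  have bE : r * D * M * b k t (xis k.+1 t) =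
      dotv (GX k t (xis k.+1 t)) (x k t - xs) - dotv (GY k t (xis k.+1 t)) (y k t - ys).
    by rewrite /b /inner_noise mulrC divfK// gt_eqF// mulr_gt0.
  apply: (le_trans h1); rewrite mulrBr sE bE !znorm_sqr/=.
  rewrite dotvNl in h3; rewrite -/(x k.+1 t) in h2.
  rewrite /GX in h2 h3 *; lra.
have s_ge0 k t s' : 0 <= s k t s'.
  have [dx dy] := Zxy k t.
  have [vx [vy [vx_sub [vy_sub _]]]] := B1 _ _ (Zxy k t).
  rewrite mulr_ge0//; last first.
    by rewrite addr_ge0//; [exact: (moreau_gap_ge0 vt_proper gamma0 _ dx vx_sub)|
      exact: (moreau_gap_ge0 om_proper gamma0 _ dy vy_sub)].
  by rewrite divr_ge0// mulr_ge0// ?sqr_ge0// ltW.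
have meanE p (Z : nat -> T -> 'rV[R]_p) t :
    \sum_(1 <= j < N.+1) (gamma / \sum_(1 <= i < N.+1) gamma) *: Z j t =
    N%:R^-1 *: \sum_(k < N) Z k.+1 t.
  rewrite big_add1 big_mkord scaler_sumr; apply: eq_bigr => k _.
  congr (_ *: _); rewrite sumr_const_nat subSS subn0 -(mulr_natr gamma) invfM mulrA.
  by rewrite divff ?gt_eqF// mul1r.
set c := _ * Om.
pose xt t := N%:R^-1 *: \sum_(k < N) x k t.
pose yt t := N%:R^-1 *: \sum_(k < N) y k t.
pose e t := primal_dual_gap vt om f xs (xt t) ys (yt t).
have [Zt e_le] : (forall t, Zdom vt om (xt t, yt t)) /\
    (forall t, e t <= N%:R^-1 * \sum_(k < N) E k t).
  have H t := primal_dual_gap_mean N.-1 vt_proper vt_cvx om_proper om_cvx f_cvx f_ccv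
    dxs dys (fun k => Zxy k t).
  by rewrite (prednK N0) in H; split => t; have [] := H t.
rewrite [X in P X](_ : _ = [set t | c <= e t]); last first.
  apply/seteqP; split => t /=;
    by rewrite !meanE (eps_phi_primal_dual_gap f vt_proper om_proper Zs (Zt t)) lee_fin.
pose sN := Num.sqrt N%:R : R.
have N0' : 0 < N%:R :> R by rewrite ltr0n.
have sN0 : 0 < sN by rewrite sqrtr_gt0.
have sNN : sN ^+ 2 = N%:R by rewrite sqr_sqrtr// ltW.
have mx1 : 1 <= Num.max theta theta^-1.
  by rewrite le_max; have [//|th1] := leP 1 theta; rewrite invf_ge1// ltW.
have [N16|N16] := leqP N 16.
  (* The threshold is then at least D M (1 + 2r) Om / 8 > r D M, so the event is empty. *)
  have sN4 : sN <= 4.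
    have : sN ^+ 2 <= 4 ^+ 2 by rewrite sNN -natrX ler_nat.
    by rewrite ler_sqr ?nnegrE// ltW.
  have ltc : r * D * M < c.
    have -> : c = D * M * (Num.max theta theta^-1 *
        ((1 + 2 * r + 2 * q theta ^+ 2) * Om) / (2 * sN)).
      by rewrite /c -/sN /r; field; rewrite gt_eqF.
    rewrite -mulrA mulrC (ltr_pM2l (mulr_gt0 D0 M0)) ltr_pdivlMr ?mulr_gt0//.
    have qq := sqr_ge0 (q theta).
    have A0 : 0 <= (1 + 2 * r + 2 * q theta ^+ 2) * Om.
      by rewrite mulr_ge0; lra.
    apply: lt_le_trans (ler_peMl A0 mx1).
    have : r * sN <= r * 4 by rewrite ler_wpM2l//; lra.
    have : (1 + 2 * r) * 4 < (1 + 2 * r) * Om by rewrite ltr_pM2l//; lra.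
    have : 0 <= q theta ^+ 2 * Om by rewrite mulr_ge0//; lra.
    lra.
  rewrite (_ : [set t | _] = set0) ?measure0 ?lee_fin ?mulr_ge0 ?expR_ge0//.
  apply/seteqP; split => // t /= cet.
  suff : e t <= r * D * M by rewrite leNgt (lt_le_trans ltc).
  apply: (le_trans (e_le t)); rewrite mulrC ler_pdivrMr//.
  apply: (@le_trans _ _ (\sum_(k < N) r * D * M)); first exact: ler_sum.
  by rewrite sumr_const card_ord mulr_natr.
(* The coefficient of W left by [threshold_rescale]; as the maximum is at least 1, l^2 <= 4/N. *)
pose l := 2 / (sN * Num.max theta theta^-1).
have me : measurable_fun setT e.
  have mxt : coord_measurable xt.
    apply: coord_measurableZ; apply: coord_measurable_sum => k.
    by have [] := mxyT k.
  have myt : coord_measurable yt.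
    apply: coord_measurableZ; apply: coord_measurable_sum => k.
    by have [] := mxyT k.
  have dxt t : edom vt (xt t) by have [] := Zt t.
  have dyt t : edom om (yt t) by have [] := Zt t.
  apply: measurable_funD; apply: measurable_funB => //.
    apply: measurable_funD; first exact: fine_lsc_measurable.
    exact: (within_continuous_measurable (within_continuous_fst f_cont dys) mxt dxt).
  apply: measurable_funB; first exact: fine_lsc_measurable.
  exact: (within_continuous_measurable (within_continuous_snd f_cont dxs) myt dyt).
apply: (@concentration _ _ _ _ _ P xis xi mxis indep mxi law s b (kappa0 / M) _ _ _ _ _
  N l r Om) => //.
- move=> k; have [mx my] := mxyX k.
  have dX1 (p : psigma k * Xi) : edom vt (x k p.1) by have [] := Zxy k p.1.
  have dY1 (p : psigma k * Xi) : edom om (y k p.1) by have [] := Zxy k p.1.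
  apply: measurable_funM => //; apply: measurable_funD.
    exact: (moreau_gap_measurable vt_proper vt_lsc gamma0 Z1.1 vx1_sub mx (mGX k) dX1).
  apply: (moreau_gap_measurable om_proper om_lsc gamma0 Z1.2 vy1_sub my _ dY1) => i.
  by under eq_fun do rewrite mxE; apply: measurable_funN; exact: mGY.
- move=> k; have [mx my] := mxyX k.
  apply: measurable_funM => //; apply: measurable_funB; apply: measurable_dotv => //.
    by apply: coord_measurableB => //; exact: coord_measurable_cst.
  by apply: coord_measurableB => //; exact: coord_measurable_cst.
- by move=> k t s'; exact: (inner_noise_bound (GB k t) M0 rho0 (near k t)).
- move=> k t; have [dx dy] := Zxy k t.
  have [vx [vy [vx_sub [vy_sub tail]]]] := B1 _ _ (Zxy k t).
  apply: (scaled_gap_exp vt_proper om_proper dx dy (mGXt k t) (mGYt k t)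
    vx_sub vy_sub M0 gamma0 tail).
  apply: measurable_funM => //; apply: measurable_funD.
    exact: (moreau_gap_measurable vt_proper vt_lsc gamma0 Z1.1 vx1_sub
      (coord_measurable_cst (x k t)) (mGXt k t) (fun _ => dx)).
  apply: (moreau_gap_measurable om_proper om_lsc gamma0 Z1.2 vy1_sub
    (coord_measurable_cst (y k t)) _ (fun _ => dy)) => i.
  by under eq_fun do rewrite mxE; apply: measurable_funN; exact: mGYt.
- move=> k t; have [vx [vy [_ [_ tail]]]] := B1 _ _ (Zxy k t).
  exact: (inner_noise_exp (mGXt k t) (mGYt k t) M0 rho0 tail (near k t)).
- have -> : l ^+ 2 = 4 / N%:R * (Num.max theta theta^-1 ^+ 2)^-1.
    by rewrite -sNN /l; field; rewrite !gt_eqF// (lt_le_trans ltr01).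
  have mx2 : 1 <= Num.max theta theta^-1 ^+ 2 by rewrite exprn_ege1.
  rewrite ler_piMr ?divr_ge0 ?(ltW N0')//.
  by rewrite invf_le1// (lt_le_trans ltr01).
- have -> : [set t | c <= e t] = setT `&` e @^-1` `[c, +oo[.
    by rewrite setTI; apply/seteqP; split => t /=; rewrite in_itv/= andbT.
  exact: me.
move=> t /= ct.
pose S := N%:R^-1 * \sum_(k < N) s k t (xis k.+1 t).
pose W := \sum_(k < N) (\int[P]_t' b k t (xi t') - b k t (xis k.+1 t)).
have S0 : 0 <= S by apply: mulr_ge0; [rewrite invr_ge0 ltW|exact: sumr_ge0].
have -> : \sum_(k < N) l * (\int[P]_t' b k t (xi t') - b k t (xis k.+1 t)) = l * W.
  by rewrite /W mulr_sumr.
have Om0 : 0 < Om by rewrite (lt_trans _ Om4).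
have := threshold_rescale (W := W) D0 M0 theta0 sN0 q0 Om0 S0.
cbv zeta; apply.
apply: (le_trans ct); apply: (le_trans (e_le t)).
rewrite -/sN -gammaE sNN ler_pM2l ?invr_gt0//.
rewrite {1}/S mulVKf ?gt_eqF//.
pose dd k := znorm (x k t - xs, y k t - ys) ^+ 2.
apply: (le_trans (ler_sum _ (fun (k : 'I_N) _ => E_step k t))).
rewrite 2!big_split/= [gamma * M ^+ 2 / 2 * _]mulr_sumr /W [r * D * M * _]mulr_sumr.
rewrite lerD2r lerD2r -mulr_suml ler_pM2r ?invr_gt0 ?mulr_gt0//.
have tel p : \sum_(k < p) (dd k - dd k.+1) = dd 0%N - dd p.
  elim: p => [|p IH]; first by rewrite big_ord0 subrr.
  by rewrite big_ord_recr/= IH; ring.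
(* The telescoped sum is D^2 minus the last squared distance, which is discarded. *)
rewrite tel lerBlDr /dd {1}/x {1}/y; have [-> ->] := init t.
by rewrite -/D lerDl sqr_ge0.
Qed.
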